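(* If $n$ is sufficiently large, then every $n$-vertex graph with at least $n(\log n)^{130}$ edges contains a cycle $C$ with at least $|C|$ chords.
   Context: All graphs are finite and simple, and logarithms are base $2$. For a cycle $C$ in a graph $G$, $|C|$ is its number of vertices, and a chord of $C$ is an edge of $G$ that joins two vertices of $C$ but is not an edge of $C$. *)

(* Defs.v *)
From mathcomp Require Import all_boot all_order all_algebra.
From mathcomp Require Import reals exp.

Set Implicit Arguments.
Unset Strict Implicit.
Unset Printing Implicit Defensive.

Record sgraph := SGraph {
  vertex :> finType;
  adj : rel vertex;
  adj_sym : symmetric adj;
  adj_irrefl : irreflexive adj }.

Definition edges (G : sgraph) : {set {set G}} :=
  [set [set p.1; p.2] | p : G * G & adj p.1 p.2].

(* The cyclic sequence of the distinct vertices of a cycle; [ucycle] alone also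
   accepts the empty sequence and the two ends of an edge. *)
Definition is_cycle (G : sgraph) (c : seq G) : Prop :=
  2 < size c /\ ucycle (@adj G) c.

Definition cycle_edges (G : sgraph) (c : seq G) : {set {set G}} :=
  [set [set x; next c x] | x in c].

Definition chords (G : sgraph) (c : seq G) : {set {set G}} :=
  [set a in edges G | a \subset c] :\: cycle_edges c.

Definition log2 (R : realType) (x : R) : R := (ln x / ln 2)%R.

(* Main.v *)
Require Import Defs.
From mathcomp Require Import all_boot all_order all_algebra.
From mathcomp Require Import reals exp.
From mathcomp Require Import zify ring lra.

Set Implicit Arguments.
Unset Strict Implicit.
Unset Printing Implicit Defensive.
Import Order.TTheory GRing.Theory Num.Theory.

(** It suffices to find two disjoint paths X and Y joined by C(|X| + |Y|) edges.
    View these edges as points of the grid X * Y: a constant fraction of the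
    triples of points has one point in the bounding box of the other two, so
    the box of some two edges contains at least |X| + |Y| + 2 of the points.
    These two edges and the sides of their box form a cycle, and all but two of
    the edges in the box are chords of it.

    With L = log n, first pass to a subgraph of maximum degree
    d = polylog(n) and average degree at least a constant times d (saturate a
    bipartite double cover greedily), and then to a subset in which every cut
    (A, B) has at least (d / O(L)) min(|A|, |B|) edges.  By Cheeger's inequality
    a lazy random walk of length polylog(n) on it avoids a fixed set of positive
    density with probability at most 2^-64.

    Take N = n / polylog(n) independent stationary walks ("gadgets"), each cut
    into three windows.  Most of them are disjoint and never return to a vertex
    they have left.  A union bound over the at most 4^N relevant pairs of sets of
    gadgets shows that for any disjoint sets F, U of N/8 gadgets, half of the
    gadgets of U have in their first (middle) window a vertex adjacent to the last
    (middle) windows of many gadgets of F.  The statement on last and first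
    windows lets depth-first search chain N/4 gadgets into a path through all
    their middle windows; the statement on middle windows provides the edges
    between the two halves X and Y of this path. *)

(** * Cycles spanned by two densely connected paths *)

(** An element of the set with least [f] has the whole set at or above it, so the bound on its upper
    part bounds the set. *)
Lemma card_top_small (T : finType) (E : {set T}) (f : T -> nat) (c t : nat) :
  c * #|[set w in E | c * #|[set p in E | f w <= f p]| < t]| <= t.
Proof.
set L := [set w in E | _].
have [->|[w0 w0L]] := set_0Vmem L; first by rewrite cards0 muln0.
case: (@arg_minnP _ w0 (fun w => w \in L) f w0L) => w.
rewrite inE => /andP[wE wt] wmin.
apply: leq_trans (ltnW wt); rewrite leq_mul2l; apply/orP; right.
apply: subset_leq_card; apply/subsetP => x xL.
by move: (xL); rewrite !inE => /andP[-> _]; rewrite wmin.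
Qed.

Lemma card_pairs (T : finType) (A B : {set T}) (R : {set T * T}) :
  setX A B \subset R -> #|A| * #|B| <= #|R|.
Proof. by rewrite -cardsX; apply: subset_leq_card. Qed.

(** Only the first coordinates of the corners [u] and [v] are ordered; their second coordinates may
    come in either order. *)
Definition in_box (u v w : nat * nat) :=
  [&& u.1 <= w.1, w.1 <= v.1, minn u.2 v.2 <= w.2 & w.2 <= maxn u.2 v.2].

(** Triples (u, v, w) with w in the box of u and v are counted twice. If every box were too small
    there would be fewer than M^3 / 512 of them, but at least half of the points w lie in the boxes
    of at least M^2 / 256 pairs. *)
Lemma box_of_points (T : finType) (E : {set T}) (f : T -> nat * nat) :
  0 < #|E| -> exists u v, [/\ u \in E, v \in E &
    #|E| <= 512 * #|[set w in E | in_box (f u) (f v) (f w)]|].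
Proof.
move=> E0; set M := #|E|.
case: (boolP [exists u in E, exists v in E,
    #|E| <= 512 * #|[set w in E | in_box (f u) (f v) (f w)]|]).
  by move=> /existsP[u /andP[uE /existsP[v /andP[vE H]]]]; exists u, v.
move=> none; exfalso.
have small u v : u \in E -> v \in E ->
    512 * #|[set w in E | in_box (f u) (f v) (f w)]| < M.
  move=> uE vE; rewrite ltnNge; apply/negP => H; move/negP: none; apply.
  by apply/existsP; exists u; rewrite uE; apply/existsP; exists v; rewrite vE.
have [B HB] : exists B, forall p, p \in E -> (f p).1 <= B /\ (f p).2 <= B.
  exists (\sum_(p in E) ((f p).1 + (f p).2)) => p pE.
  by rewrite (bigD1 p) //=; split; lia.
pose R w := [set p : T * T | [&& p.1 \in E, p.2 \in E & in_box (f p.1) (f p.2) (f w)]].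
(* [top g] is the extreme eighth of the points in one direction. The subtractions from the common
   bound [B] in [g3] and [g4] reverse the two coordinates, so the four sets that form [bad] cover at
   most half of the points. *)
pose top (g : T -> nat) := [set w in E | 8 * #|[set p in E | g w <= g p]| < M].
pose g1 p := (f p).1. pose g2 p := (f p).2.
pose g3 p := B - (f p).1. pose g4 p := B - (f p).2.
pose bad := top g1 :|: top g2 :|: top g3 :|: top g4.
have badM : 2 * #|bad| <= M.
  have t1 : 8 * #|top g1| <= M by apply: card_top_small.
  have t2 : 8 * #|top g2| <= M by apply: card_top_small.
  have t3 : 8 * #|top g3| <= M by apply: card_top_small.
  have t4 : 8 * #|top g4| <= M by apply: card_top_small.
  by rewrite /bad !cardsU; lia.
have goodR w : w \in E -> w \notin bad -> M * M <= 256 * #|R w|.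
  move=> wE; rewrite !inE wE /= !negb_or -!leqNgt => /andP[/andP[/andP[h1 h2] h3] h4].
  (* These are the four closed quadrants around [w]. Each of the four half-planes holds at least M /
     8 points, so two opposite quadrants hold at least M / 16 each, and any point of one and any
     point of the other span a box around [w]. *)
  pose Q (a b : bool) := [set p in E |
     (if a then g1 w <= g1 p else g1 p <= g1 w) && (if b then g2 w <= g2 p else g2 p <= g2 w)].
  have rect a : #|Q false a| * #|Q true (~~ a)| <= #|R w|.
    apply: card_pairs; apply/subsetP => -[p q].
    rewrite !inE /= /in_box => /andP[/andP[-> /andP[p1 p2]] /andP[-> /andP[q1 q2]]] /=.
    by rewrite p1 q1; case: a p2 q2 => /= p2 q2; rewrite /g2 in p2 q2; lia.
  have side (g : T -> nat) a1 b1 a2 b2 :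
      M <= 8 * #|[set p in E | g w <= g p]| ->
      (forall p, p \in E -> g w <= g p -> p \in Q a1 b1 :|: Q a2 b2) ->
      M <= 8 * (#|Q a1 b1| + #|Q a2 b2|).
    move=> hM hs; apply: leq_trans hM _; rewrite leq_mul2l /=.
    apply: leq_trans (_ : #|Q a1 b1 :|: Q a2 b2| <= _); last by rewrite cardsU leq_subr.
    by apply: subset_leq_card; apply/subsetP => p; rewrite inE => /andP[pE]; apply: hs.
  have [Bw1 Bw2] := HB w wE.
  have s1 : M <= 8 * (#|Q true true| + #|Q true false|).
    apply: (side g1) => // p pE gp; rewrite !inE pE /= gp /=; exact: leq_total.
  have s2 : M <= 8 * (#|Q true true| + #|Q false true|).
    apply: (side g2) => // p pE gp; rewrite !inE pE /= gp /= !andbT; exact: leq_total.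
  have s3 : M <= 8 * (#|Q false true| + #|Q false false|).
    apply: (side g3) => // p pE gp; have [Bp1 Bp2] := HB p pE.
    have gp' : g1 p <= g1 w by rewrite /g1; rewrite /g3 in gp; lia.
    rewrite !inE pE /= gp' /=; exact: leq_total.
  have s4 : M <= 8 * (#|Q true false| + #|Q false false|).
    apply: (side g4) => // p pE gp; have [Bp1 Bp2] := HB p pE.
    have gp' : g2 p <= g2 w by rewrite /g2; rewrite /g4 in gp; lia.
    rewrite !inE pE /= gp' /= !andbT; exact: leq_total.
  have r1 := rect true; have r2 := rect false.
  have: M <= 16 * #|Q true true| /\ M <= 16 * #|Q false false| \/
        M <= 16 * #|Q true false| /\ M <= 16 * #|Q false true| by lia.
  by case=> -[k1 k2]; [move: (leq_mul k1 k2) r2|move: (leq_mul k1 k2) r1] => /=; nia.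
have cnt : \sum_(w in E) #|R w| =
    \sum_(p in setX E E) #|[set w in E | in_box (f p.1) (f p.2) (f w)]|.
  transitivity (\sum_(w in E) \sum_(p in setX E E) in_box (f p.1) (f p.2) (f w)).
    apply: eq_bigr => w _; rewrite -sum1_card big_mkcond [RHS]big_mkcond.
    apply: eq_bigr => -[p q] _; rewrite !inE /=.
    by case: (p \in E); case: (q \in E); case: in_box.
  rewrite exchange_big /=; apply: eq_bigr => p _.
  rewrite -sum1_card big_mkcond [RHS]big_mkcond; apply: eq_bigr => w _; rewrite !inE.
  by case: (w \in E); case: in_box.
have up : 512 * \sum_(w in E) #|R w| < M * (M * M).
  rewrite cnt big_distrr /=.
  have [x0 x0E] : exists x, x \in E by apply/set0Pn; rewrite -card_gt0.
  apply: leq_ltn_trans (_ : \sum_(p in setX E E) M.-1 < _).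
    apply: leq_sum => -[p q]; rewrite inE /= => /andP[pE qE].
    by have := small p q pE qE; lia.
  rewrite sum_nat_const cardsX -/M; have M0 : 0 < M by [].
  by nia.
have low : (M - #|bad|) * (M * M) <= 256 * \sum_(w in E) #|R w|.
  rewrite big_distrr /= (bigID (fun w => w \in bad)) /=.
  apply: leq_trans (leq_addl _ _).
  have -> : M - #|bad| = #|E :\: bad|.
    rewrite cardsD; congr (_ - _); apply/esym; congr #|pred_of_set _|; apply/setIidPr.
    by apply/subsetP => x; rewrite !inE -!orbA => /or4P[] /andP[].
  rewrite -sum_nat_const.
  rewrite [X in X <= _](eq_bigl (fun w => (w \in E) && (w \notin bad))); last first.
    by move=> w; rewrite inE andbC.
  by apply: leq_sum => w /andP[wE wb]; apply: goodR.
by nia.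
Qed.

Lemma next_mid (T : eqType) (s1 s2 : seq T) x z :
  uniq (s1 ++ x :: z :: s2) -> next (s1 ++ x :: z :: s2) x = z.
Proof.
move=> U; rewrite -(next_rot (size s1) U) rot_size_cat /=.
by rewrite eqxx.
Qed.

Lemma next_last (T : eqType) (s : seq T) x y :
  uniq (y :: rcons s x) -> next (y :: rcons s x) x = y.
Proof.
move=> U; rewrite -(next_rot (size (y :: s)) U) -rcons_cons -cats1 rot_size_cat /=.
by rewrite eqxx.
Qed.

Lemma mem_split_succ (T : eqType) (s : seq T) x x0 : x \in s ->
  x = last x0 s \/ exists s1 z s2, s = s1 ++ x :: z :: s2.
Proof.
move=> /splitPr[s1 [|z s2]]; first by left; rewrite last_cat.
by right; exists s1, z, s2.
Qed.

Lemma set2_eq (T : finType) (a b c d : T) :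
  [set a; b] = [set c; d] -> a = c /\ b = d \/ a = d /\ b = c.
Proof.
move=> /setP E.
have Ea : (a == c) || (a == d) by move: (E a); rewrite !inE eqxx.
have Eb : (b == c) || (b == d) by move: (E b); rewrite !inE eqxx orbT.
have Ec : (c == a) || (c == b) by move: (E c); rewrite !inE eqxx.
have Ed : (d == a) || (d == b) by move: (E d); rewrite !inE eqxx orbT.
move: Ea Eb Ec Ed => /orP[]/eqP-> /orP[]/eqP-> /orP[]/eqP h1 /orP[]/eqP h2; subst; auto.
Qed.

(** The only edges of the cycle that run between the two paths are the two that join their ends. All
    other edges between the paths are chords. *)
Lemma cycle_of_two_paths (G : sgraph) (x y : G) (A B : seq G) :
  uniq ((x :: A) ++ (y :: B)) -> path (@adj G) x A -> path (@adj G) y B ->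
  adj (last x A) y -> adj (last y B) x ->
  size (x :: A) + size (y :: B) + 2 <=
    #|[set p : G * G | [&& p.1 \in x :: A, p.2 \in y :: B & adj p.1 p.2]]| ->
  exists c : seq G, is_cycle c /\ size c <= #|chords c|.
Proof.
set P := [set p | _] => U pA pB aAB aBA big.
set A' := x :: A; set B' := y :: B; set c := A' ++ B'.
have disj a : a \in A' -> a \in B' -> False.
  move=> aA aB; move: U; rewrite cat_uniq => /and3P[_ /hasPn /(_ a aB)].
  by rewrite /= aA.
have Pin a b : ((a, b) \in P) = [&& a \in A', b \in B' & adj a b] by rewrite inE.
have P_le : #|P| <= size A' * size B'.
  rewrite -[leqRHS](_ : #|setX [set a in A'] [set b in B']| = _); last first.
    rewrite cardsX !cardsE; move: U; rewrite cat_uniq => /and3P[U1 _ U2].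
    by rewrite !(card_uniqP _).
  by apply: subset_leq_card; apply/subsetP => -[a b]; rewrite Pin in_setX !in_set => /and3P[-> ->].
exists c; split.
  split; last first.
    rewrite /ucycle U andbT /c /A' /=.
    by rewrite rcons_cat cat_path pA /= aAB rcons_path pB /= aBA.
  (* The number of edges between the paths is at most the product of their sizes, which excludes
     degenerate cycles. *)
  have h : size A' + size B' + 2 <= size A' * size B' by apply: leq_trans P_le.
  by rewrite /c size_cat; nia.
pose f (p : G * G) := [set p.1; p.2].
have f_inj : {in P &, injective f}.
  move=> [a b] [a' b']; rewrite !Pin => /and3P[aA bB _] /and3P[aA' bB' _] /set2_eq /=.
  by case=> -[E1 E2]; [rewrite E1 E2|case: (disj a); rewrite // E1].
have cut : f @: P :\: [set [set last x A; y]; [set last y B; x]] \subset chords c.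
  apply/subsetP => e /setDP[/imsetP[[a b]]]; rewrite Pin => /and3P[aA bB ab] -> nc.
  rewrite inE; apply/andP; split; last first.
    rewrite inE; apply/andP; split; first by apply/imsetP; exists (a, b); rewrite ?inE.
    by apply/subsetP => z; rewrite in_set2 => /orP[]/eqP->; rewrite mem_cat ?aA ?bB ?orbT.
  apply/imsetP => -[z zc /esym /set2_eq E]; apply: (negP nc).
  rewrite in_set2.
  have nextA s1 z' s2 : A' = s1 ++ z :: z' :: s2 -> False.
    move=> Es; have nz : next c z = z'.
      by rewrite /c Es -catA /= next_mid //; move: U; rewrite -/A' Es -catA.
    have zA : z \in A' by rewrite Es mem_cat inE eqxx orbT.
    have zA' : z' \in A' by rewrite Es mem_cat !inE eqxx !orbT.
    by case: E; rewrite nz /= => -[E1 E2]; apply: (disj b); rewrite // -?E1 -?E2.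
  have nextB s1 z' s2 : B' = s1 ++ z :: z' :: s2 -> False.
    move=> Es; have nz : next c z = z'.
      by rewrite /c Es catA next_mid //; move: U; rewrite -/B' Es catA.
    have zA : z \in B' by rewrite Es mem_cat inE eqxx orbT.
    have zA' : z' \in B' by rewrite Es mem_cat !inE eqxx !orbT.
    by case: E; rewrite nz /= => -[E1 E2]; apply: (disj a); rewrite // -?E1 -?E2.
  move: zc; rewrite mem_cat => /orP[zA|zB].
    case: (mem_split_succ x zA) => [zl|[s1 [z' [s2 /nextA]]]] //.
    have El : A' = rcons (belast x A) (last x A) by rewrite -lastI.
    have cE : c = belast x A ++ last x A :: y :: B by rewrite /c El cat_rcons.
    have zl' : z = last x A by rewrite zl.
    have nz : next c z = y by rewrite zl' cE next_mid // -cE.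
    by move: E; rewrite nz zl' /= => -[] [<- <-]; rewrite /f /= ?eqxx // setUC eqxx.
  case: (mem_split_succ y zB) => [zl|[s1 [z' [s2 /nextB]]]] //.
  have cE : c = x :: rcons (A ++ belast y B) (last y B).
    by rewrite /c /B' lastI -rcons_cat.
  have zl' : z = last y B by rewrite zl.
  have nz : next c z = x by rewrite zl' cE next_last // -cE.
  by move: E; rewrite nz zl' /= => -[] [<- <-]; rewrite /f /= ?eqxx ?orbT // setUC eqxx ?orbT.
apply: leq_trans (subset_leq_card cut).
rewrite cardsD (card_in_imset f_inj) size_cat.
set I := _ :&: _; have I2 : #|I| <= 2.
  apply: leq_trans (subset_leq_card (subsetIr _ _)) _; rewrite cards2; by case: (_ == _).
move: big; rewrite -/P -/A' -/B'; lia.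
Qed.

Lemma interval_split (T : eqType) (s : seq T) (a b : T) :
  a \in s -> b \in s -> index a s <= index b s ->
  exists s1 m s2, [/\ s = s1 ++ (a :: m) ++ s2, last a m = b &
    forall w, w \in s -> index a s <= index w s <= index b s -> w \in a :: m].
Proof.
move=> as_ bs ab; set i := index a s; set j := index b s.
have js : j < size s by rewrite index_mem.
have E1 : drop i (take j.+1 s) = a :: drop i.+1 (take j.+1 s).
  rewrite (drop_nth a); last by rewrite size_takel // ltnS.
  by rewrite nth_take ?ltnS // nth_index.
exists (take i s), (drop i.+1 (take j.+1 s)), (drop j.+1 s); split.
- rewrite -E1 catA -[in LHS](cat_take_drop j.+1 s); congr (_ ++ _).
  by rewrite -[in LHS](cat_take_drop i (take j.+1 s)) take_takel // ltnW.
- rewrite -[LHS]/(last b (a :: drop i.+1 (take j.+1 s))) -E1 (take_nth b) //.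
  by rewrite drop_rcons ?size_takel ?last_rcons ?nth_index // ltnW.
move=> w ws /andP[iw wj]; rewrite -E1.
have: w \in take j.+1 s by rewrite in_take // ltnS.
rewrite -{1}(cat_take_drop i (take j.+1 s)) mem_cat take_takel; last exact: ltnW.
by rewrite in_take // ltnNge iw.
Qed.

Lemma cycle_of_dense_paths (G : sgraph) (X Y : seq G) :
  uniq (X ++ Y) -> sorted (@adj G) X -> sorted (@adj G) Y ->
  512 * (size X + size Y + 2) <=
    #|[set p : G * G | [&& p.1 \in X, p.2 \in Y & adj p.1 p.2]]| ->
  exists c : seq G, is_cycle c /\ size c <= #|chords c|.
Proof.
set E := [set p | _] => U sX sY big.
have Ein a b : ((a, b) \in E) = [&& a \in X, b \in Y & adj a b] by rewrite inE.
pose f (p : G * G) := (index p.1 X, index p.2 Y).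
have [|[u1 u2] [[v1 v2] [uE vE box]]] := @box_of_points _ E f.
  by apply: leq_trans big; rewrite muln_gt0 addnS.
set Bx := [set w in E | _] in box.
have boxs : size X + size Y + 2 <= #|Bx| by have := leq_trans big box; rewrite leq_pmul2l.
move: uE vE; rewrite !Ein => /and3P[u1X u2Y au] /and3P[v1X v2Y av].
(* Any point of the box shows that [u1] precedes [v1] on [X]. *)
have [[w1 w2]] : exists w, w \in Bx.
  by apply/set0Pn; rewrite -card_gt0; apply: leq_trans boxs; rewrite addnS.
rewrite inE Ein => /andP[_ /and4P[/= l1 l2 _ _]].
have uv1 := leq_trans l1 l2.
have [s1 [m [s2 [EX lX memX]]]] := interval_split u1X v1X uv1.
have pA : path (@adj G) u1 m.
  by move: sX; rewrite EX => /cat_sorted2[_ /cat_sorted2[]].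
(* The cycle returns along [Y] from [v2] to [u2]. If [u2] comes first the segment is reversed, hence
   [perm_eq] in place of equality. *)
have [t1 [B [t2 [EY pB lB memB]]]] : exists t1 B t2,
    [/\ perm_eq Y (t1 ++ (v2 :: B) ++ t2), path (@adj G) v2 B, last v2 B = u2 &
     forall w, w \in Y -> minn (index u2 Y) (index v2 Y) <= index w Y ->
       index w Y <= maxn (index u2 Y) (index v2 Y) -> w \in v2 :: B].
  have [le|/ltnW le] := leqP (index v2 Y) (index u2 Y).
    have [t1 [B [t2 [EY lY memY]]]] := interval_split v2Y u2Y le.
    exists t1, B, t2; split => //; first by rewrite {1}EY.
      by move: sY; rewrite EY => /cat_sorted2[_ /cat_sorted2[]].
    by move=> w wY h1 h2; apply: memY; rewrite ?h1.
  have [t1 [B [t2 [EY lY memY]]]] := interval_split u2Y v2Y le.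
  have pB : path (@adj G) u2 B by move: sY; rewrite EY => /cat_sorted2[_ /cat_sorted2[]].
  have Er : rev (u2 :: B) = v2 :: rev (belast u2 B) by rewrite lastI rev_rcons lY.
  exists t1, (rev (belast u2 B)), t2; split.
  - by rewrite {1}EY perm_cat2l perm_cat2r -Er perm_sym perm_rev.
  - rewrite -lY rev_path; apply: sub_path pB => x y; by rewrite adj_sym.
  - by rewrite -[LHS]/(last v2 (v2 :: rev (belast u2 B))) -Er rev_cons last_rcons.
  by move=> w wY h1 h2; rewrite -Er mem_rev; apply: memY; rewrite ?h1.
have sub : size (u1 :: m) + size (v2 :: B) + 2 <= size X + size Y + 2.
  have := congr1 size EX; have := perm_size EY; rewrite !size_cat => -> ->.
  by clear; move: (size (u1 :: m)) (size (v2 :: B)) => *; lia.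
apply: (cycle_of_two_paths (x := u1) (y := v2) (A := m) (B := B)) => //.
- have: uniq (s1 ++ (u1 :: m) ++ s2 ++ (t1 ++ (v2 :: B) ++ t2)).
    rewrite -(perm_uniq (s1 := X ++ Y)) //; rewrite {1}EX -!catA.
    by rewrite !perm_cat2l.
  apply: subseq_uniq; apply: subseq_trans (suffix_subseq _ _).
  apply: cat_subseq (subseq_refl _) _.
  apply: subseq_trans (suffix_subseq _ _); apply: subseq_trans (suffix_subseq _ _).
  exact: prefix_subseq.
- by rewrite lX.
- by rewrite lB adj_sym.
apply: leq_trans sub _; apply: leq_trans boxs _; apply: subset_leq_card.
apply/subsetP => -[a b]; rewrite [(a, b) \in Bx]inE Ein => /andP[/and3P[aX bY ab] /and4P[/= h1 h2 h3 h4]].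
by rewrite inE /= ab andbT memX ?memB // ?h1 ?h2.
Qed.

(** * Depth-first search *)

(* Each step of the search, with stack p, finished set F and unvisited set U,
   lowers |U| - |F| by one; at the time |U| = |F| both are smaller than m. *)
Lemma dfs_long_path (T : finType) (e : rel T) (J : {set T}) (m : nat) :
  (forall F U : {set T}, F \subset J -> U \subset J -> [disjoint F & U] ->
     m <= #|F| -> m <= #|U| -> exists f u, [/\ f \in F, u \in U & e f u]) ->
  exists p : seq T, [/\ uniq p, sorted e p, {subset p <= J} & #|J| < size p + 2 * m].
Proof.
move=> H.
(* [j] counts the steps made. The stack has its top at the head, hence the reversed relation in
   [sorted]. *)
pose inv (j : nat) (F U : {set T}) (p : seq T) :=
  [/\ uniq p, sorted (fun x y => e y x) p & {subset p <= J}] /\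
  [/\ F \subset J, U \subset J, [disjoint F & U], [disjoint F & p] & [disjoint U & p]] /\
  [/\ (forall f u, f \in F -> u \in U -> ~~ e f u),
      #|F| + #|U| + size p = #|J| & #|U| + j = #|J| + #|F|].
have st j : j <= #|J| -> exists F U p, inv j F U p.
  elim: j => [|j IH] jJ.
    exists set0, J, [::]; split; [split|split; split] => //.
    - exact: sub0set.
    - by apply/pred0P => x /=; rewrite inE.
    - by apply/pred0P => x /=; rewrite inE.
    - by apply/pred0P => x /=; rewrite in_nil andbF.
    - by move=> f u; rewrite inE.
    - by rewrite cards0 add0n addn0.
    - by rewrite cards0 addn0.
  have [F [U [p [[up sp pJ] [[FJ UJ dFU dFp dUp] [noarc c1 c2]]]]]] := IH (ltnW jJ).
  have [u uU] : exists u, u \in U by apply/set0Pn; rewrite -card_gt0; move: c2 jJ; clear; lia.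
  have push v : v \in U -> sorted (fun x y => e y x) (v :: p) ->
      exists F U p, inv j.+1 F U p.
    move=> vU sv; have vJ := subsetP UJ v vU.
    have cU := cardsD1 v U; rewrite vU /= in cU.
    have vp : v \notin p.
      by apply/negP => vp; move/pred0P: dUp => /(_ v) /=; rewrite vU vp.
    exists F, (U :\ v), (v :: p); split; [split|split; split] => //=.
    - by rewrite vp.
    - by move=> x; rewrite inE => /orP[/eqP->|/pJ].
    - by apply: subset_trans UJ; apply: subsetDl.
    - by apply: disjointWr dFU; apply: subsetDl.
    - rewrite disjoint_sym disjoint_cons disjoint_sym dFp andbT.
      by apply/negP => vF; move/pred0P: dFU => /(_ v) /=; rewrite vU vF.
    - rewrite disjoint_sym disjoint_cons !inE eqxx /= disjoint_sym.
      by apply: disjointWl dUp; apply: subsetDl.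
    - by move=> f w fF; rewrite !inE => /andP[_]; apply: noarc.
    - by move: c1 cU; rewrite /=; clear; lia.
    - by move: c2 cU; clear; lia.
  case: p up sp pJ dFp dUp c1 push => [|x p] up sp pJ dFp dUp c1 push.
    exact: (push u).
  case: (boolP [exists v in U, e x v]) => [/existsP[v /andP[vU xv]]|none].
    by apply: (push v) => //=; rewrite xv.
  have xJ : x \in J by apply: pJ; rewrite inE eqxx.
  have xF : x \notin F.
    by apply/negP => xF; move/pred0P: dFp => /(_ x) /=; rewrite xF inE eqxx.
  have xU : x \notin U.
    by apply/negP => xU; move/pred0P: dUp => /(_ x) /=; rewrite xU inE eqxx.
  move: up => /= /andP[xp up].
  exists (x |: F), U, p; split; [split|split; split] => //.
  - by move: sp; apply: path_sorted.
  - by move=> y yp; apply: pJ; rewrite inE yp orbT.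
  - by rewrite subUset sub1set xJ.
  - apply/pred0P => y /=; rewrite !inE; case: eqP => [->|_]; first exact: negbTE xU.
    by move/pred0P: dFU => /(_ y).
  - apply/pred0P => y /=; rewrite !inE; case: eqP => [->|_]; first exact: negbTE xp.
    apply: contraFF (pred0P dFp y) => /= /andP[-> yp]; by rewrite inE yp orbT.
  - by apply: disjointWr dUp; apply/subsetP => y yp; rewrite inE yp orbT.
  - move=> f v; rewrite !inE => /orP[/eqP->|fF] vU; last exact: noarc.
    by apply: contra none => xv; apply/existsP; exists v; rewrite vU.
  - by move: c1; rewrite cardsU1 xF /=; clear; lia.
  - by move: c2; rewrite cardsU1 xF; clear; lia.
have [F [U [p [[up sp pJ] [[FJ UJ dFU dFp dUp] [noarc c1 c2]]]]]] := st _ (leqnn _).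
exists (rev p); split; rewrite ?rev_uniq ?rev_sorted ?size_rev //.
  by move=> x; rewrite mem_rev; apply: pJ.
suff: #|F| < m by move: c1 c2; clear; lia.
rewrite ltnNge; apply/negP => mF.
have [|f [u [fF uU]]] := H F U FJ UJ dFU mF; first by move: mF c2; clear; lia.
by apply/negP; apply: noarc.
Qed.

(** * Resampling in a product of finite weights *)

Section ProductWeights.
Local Open Scope ring_scope.
Variables (R : realFieldType) (T : finType) (mu : T -> R).
Hypothesis mu_ge0 : forall g, 0 <= mu g.
Hypothesis mu_sum : \sum_g mu g = 1.

Definition prodw (I : finType) (w : {ffun I -> T}) : R := \prod_i mu (w i).

Definition upd (I : finType) (w : {ffun I -> T}) (i : I) (g : T) : {ffun I -> T} :=
  [ffun j => if j == i then g else w j].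

Lemma prodw_ge0 (I : finType) (w : {ffun I -> T}) : 0 <= prodw w.
Proof. by apply: prodr_ge0 => i _. Qed.

Lemma prodw_sum (I : finType) : \sum_(w : {ffun I -> T}) prodw w = 1.
Proof.
by rewrite /prodw -(bigA_distr_bigA (fun _ => mu)) /= big1 // => i _; apply: mu_sum.
Qed.

(** The weight of a pair of a family [w] and a fresh sample [g] is invariant under exchanging [g]
    with the coordinate [w i]. *)
Lemma resample (I : finType) (i : I) (F : {ffun I -> T} -> R) :
  \sum_w prodw w * F w = \sum_w prodw w * \sum_g mu g * F (upd w i g).
Proof.
pose sw (p : {ffun I -> T} * T) := (upd p.1 i p.2, p.1 i).
have swK : involutive sw.
  move=> [w g]; rewrite /sw /=; congr (_, _); last by rewrite ffunE eqxx.
  by apply/ffunP => j; rewrite !ffunE; case: eqP => [->|].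
have E p : prodw (sw p).1 * mu (sw p).2 = prodw p.1 * mu p.2.
  case: p => w g; rewrite /prodw /= (bigD1 i) //= [in RHS](bigD1 i) //= ffunE eqxx.
  rewrite (eq_bigr (fun j => mu (w j))); first by ring.
  by move=> j /negbTE ji; rewrite ffunE ji.
transitivity (\sum_(p : {ffun I -> T} * T) prodw p.1 * mu p.2 * F p.1).
  rewrite -(pair_bigA _ (fun w g => prodw w * mu g * F w)) /=.
  by apply: eq_bigr => w _; rewrite -mulr_suml -mulr_sumr mu_sum mulr1.
rewrite (reindex_inj (inv_inj swK)) /=.
rewrite (eq_bigr (fun p => prodw p.1 * mu p.2 * F (upd p.1 i p.2))); last first.
  by move=> p _; rewrite E.
rewrite -(pair_bigA _ (fun w g => prodw w * mu g * F (upd w i g))) /=.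
by apply: eq_bigr => w _; rewrite mulr_sumr; apply: eq_bigr => g _; rewrite mulrA.
Qed.

(* Independence enters only through resampling: the coordinates of S are
   resampled from the largest to the smallest. *)
Lemma all_fail_le (N : nat) (fail : 'I_N -> {ffun 'I_N -> T} -> bool) (eta : R)
    (S : {set 'I_N}) :
  0 <= eta ->
  (forall i w, i \in S -> \sum_g mu g * (fail i (upd w i g))%:R <= eta) ->
  (forall i j w g, i \in S -> j \in S -> (i < j)%N -> fail i (upd w j g) = fail i w) ->
  \sum_w prodw w * [forall i in S, fail i w]%:R <= eta ^+ #|S|.
Proof.
move=> eta0; move En : #|S| => n; elim: n S En => [|n IH] S En Hp Hi.
  rewrite expr0 -[leRHS](prodw_sum 'I_N); apply: ler_sum => w _.
  apply: ler_piMr; first exact: prodw_ge0.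
  by rewrite lern1 leq_b1.
have [x xS] : exists x, x \in S by apply/set0Pn; rewrite -card_gt0 En.
case: (@arg_maxnP _ x (fun i => i \in S) (fun i => nat_of_ord i) xS) => i iS imax.
have cS := cardsD1 i S; rewrite iS En /= in cS.
have inS' j : j \in S :\ i -> j \in S /\ (j < i)%N.
  rewrite !inE => /andP[ji jS]; split => //.
  have le : (j <= i)%N := imax j jS.
  by rewrite ltn_neqAle le andbT.
rewrite (resample i).
apply: le_trans (_ : \sum_w prodw w * ([forall j in S :\ i, fail j w]%:R * eta) <= _).
  apply: ler_sum => w _; apply: ler_wpM2l; first exact: prodw_ge0.
  apply: le_trans (_ : \sum_g mu g * ([forall j in S :\ i, fail j w]%:R
      * (fail i (upd w i g))%:R) <= _).
    apply: ler_sum => g _; apply: ler_wpM2l => //.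
    rewrite -natrM ler_nat mulnb.
    case: (boolP [forall j in S, _]) => // /forallP H; rewrite lt0b.
    have := H i; rewrite iS /= => ->; rewrite andbT.
    apply/forallP => j; apply/implyP => /[dup] /inS'[jS ji] _.
    by have := H j; rewrite jS /= Hi.
  rewrite (eq_bigr (fun g => [forall j in S :\ i, fail j w]%:R
      * (mu g * (fail i (upd w i g))%:R))); last by move=> g _; rewrite mulrCA.
  by rewrite -mulr_sumr; apply: ler_wpM2l => //; apply: Hp.
rewrite (eq_bigr (fun w => (prodw w * [forall j in S :\ i, fail j w]%:R) * eta)); last first.
  by move=> w _; rewrite mulrA.
rewrite -mulr_suml exprSr; apply: ler_wpM2r => //; apply: IH; first by case: cS.
- by move=> j w /inS'[jS _]; apply: Hp.
- by move=> j k w g /inS'[jS _] /inS'[kS _]; apply: Hi.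
Qed.

Lemma prodw_exists (I : finType) (F : {ffun I -> T} -> R) :
  \sum_w prodw w * F w < 1 -> exists w, F w < 1.
Proof.
move=> H; apply/existsP; apply: contraTT H; rewrite -leNgt => /existsPn H.
rewrite -[leLHS](prodw_sum I); apply: ler_sum => w _.
apply: ler_peMr; first exact: prodw_ge0.
by rewrite leNgt; apply: H.
Qed.

End ProductWeights.

(** * Conductance and the lazy random walk *)

Section CauchySchwarz.
Local Open Scope ring_scope.

(** By Lagrange's identity, twice the difference of the two sides is a weighted sum of the squares
    of [a i * b j - a j * b i]. *)
Lemma cauchy_schwarz (R : realFieldType) (I : finType) (w a b : I -> R) :
  (forall i, 0 <= w i) ->
  (\sum_i w i * (a i * b i)) ^+ 2 <= (\sum_i w i * a i ^+ 2) * (\sum_i w i * b i ^+ 2).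
Proof.
move=> w0.
have H : 0 <= \sum_i \sum_j w i * w j * (a i * b j - a j * b i) ^+ 2.
  apply: sumr_ge0 => i _; apply: sumr_ge0 => j _.
  by apply: mulr_ge0; [apply: mulr_ge0|apply: sqr_ge0].
have E : \sum_i \sum_j w i * w j * (a i * b j - a j * b i) ^+ 2 =
    2%:R * ((\sum_i w i * a i ^+ 2) * (\sum_i w i * b i ^+ 2) - (\sum_i w i * (a i * b i)) ^+ 2).
  have E1 (f g : I -> R) : (\sum_i f i) * (\sum_j g j) = \sum_i \sum_j f i * g j.
    by rewrite mulr_suml; apply: eq_bigr => i _; rewrite mulr_sumr.
  have F (x y z : R) : 2%:R * (x * y - z ^+ 2) = x * y + y * x - (z * z + z * z) by ring.
  rewrite F !E1 -!big_split -sumrB /=.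
  apply: eq_bigr => i _; rewrite -!big_split -sumrB /=; apply: eq_bigr => j _.
  by ring.
by move: H; rewrite E; lra.
Qed.

End CauchySchwarz.

Section Cheeger.
Local Open Scope ring_scope.
Variables (R : realFieldType) (V : finType) (h : rel V) (D : nat) (U : {set V}) (phi : R).
Hypothesis h_sym : symmetric h.
Hypothesis D_gt0 : (0 < D)%N.
Hypothesis degD : forall x, (#|[set y | h x y]| <= D)%N.
Hypothesis phi_ge0 : 0 <= phi.
Hypothesis expand : forall A : {set V}, A \subset U ->
  phi * #|A|%:R <= (\sum_(x in A) \sum_(y in ~: A) h x y)%:R.

Lemma sum_h x : \sum_y (h x y)%:R = #|[set y | h x y]|%:R :> R.
Proof.
rewrite -natr_sum; congr _%:R; rewrite -sum1_card [RHS]big_mkcond /=.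
by apply: eq_bigr => y _; rewrite inE; case: (h x y).
Qed.

(** Induction on the support [A] of [u], peeling off its lowest layer: lowering [u] by its least
    value [c] on [A] costs [c * #|A|] in the sum of [u] and twice [c] times the cut of [A] on the
    right, and [expand] compares the two. *)
Lemma coarea (u : V -> R) :
  (forall x, 0 <= u x) -> (forall x, x \notin U -> u x = 0) ->
  2%:R * phi * \sum_x u x <= \sum_x \sum_y (h x y)%:R * `|u x - u y|.
Proof.
move En : #|[set x | u x != 0]| => n; elim/ltn_ind: n u En => n IH u En u0 uU.
set A := [set x | u x != 0] in En.
have Aout x : x \notin A -> u x = 0 by rewrite inE negbK => /eqP.
have [A0|[x0 x0A]] := set_0Vmem A.
  have uz x : u x = 0 by apply: Aout; rewrite A0 inE.
  rewrite (eq_bigr (fun _ => 0)) // big1 // mulr0; apply: sumr_ge0 => x _.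
  by apply: sumr_ge0 => y _; rewrite mulr_ge0.
have [z zA zmin] : exists2 z, z \in A & forall x, x \in A -> u z <= u x.
  by case: (@Order.TotalTheory.arg_minP _ _ _ x0 (fun x => x \in A) u x0A) => z; exists z.
set c := u z.
have AU : A \subset U.
  apply/subsetP => x; rewrite inE; apply: contraR => xU; by rewrite uU.
pose u' x := u x - c * (x \in A)%:R.
have u'0 x : 0 <= u' x.
  rewrite /u'; case: (boolP (x \in A)) => xA; last by rewrite mulr0 subr0.
  by rewrite mulr1 subr_ge0 zmin.
have lt : (#|[set x | u' x != 0%R]| < n)%N.
  rewrite -En; apply: proper_card; apply/properP; split.
    apply/subsetP => x; rewrite !inE; apply: contraNneq => ux.
    by rewrite /u' inE ux eqxx /= mulr0 subr0.
  by exists z => //; rewrite inE /u' zA mulr1 subrr eqxx.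
have {}IH := IH _ lt u' erefl u'0.
have IH' : 2%:R * phi * \sum_x u' x <= \sum_x \sum_y (h x y)%:R * `|u' x - u' y|.
  apply: IH => x xU; rewrite /u' uU // (_ : x \in A = false) ?mulr0 ?subr0 //.
  by apply/negbTE; apply: contra xU => /(subsetP AU).
have c0 : 0 <= c by exact: u0.
pose B x y : R := ((x \in A) && (y \notin A))%:R.
have pt x y : `|u x - u y| = `|u' x - u' y| + c * (B x y + B y x).
  rewrite /u' /B; case: (boolP (x \in A)) => xA; case: (boolP (y \in A)) => yA /=.
  - by rewrite !(mulr1, addr0, mulr0) opprB addrA subrK.
  - rewrite (Aout y yA) !(mulr1, addr0, mulr0, subr0) ger0_norm; last exact: u0.
    by rewrite ger0_norm ?subrK // subr_ge0 zmin.
  - rewrite (Aout x xA) !(mulr1, add0r, mulr0, subr0, oppr0, sub0r, normrN).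
    rewrite ger0_norm; last exact: u0.
    by rewrite ger0_norm ?subrK // subr_ge0 zmin.
  - by rewrite (Aout x xA) (Aout y yA) !(mulr0, addr0, subr0).
have cutE : \sum_x \sum_y (h x y)%:R * B x y = (\sum_(x in A) \sum_(y in ~: A) h x y)%:R.
  rewrite natr_sum [RHS]big_mkcond /=; apply: eq_bigr => x _; rewrite /B.
  case: (x \in A) => /=; last by rewrite big1 // => y _; rewrite mulr0.
  rewrite natr_sum [RHS]big_mkcond /=; apply: eq_bigr => y _; rewrite in_setC.
  by case: (y \in A); rewrite /= ?mulr0 ?mulr1.
have cutE' : \sum_x \sum_y (h x y)%:R * B y x = (\sum_(x in A) \sum_(y in ~: A) h x y)%:R.
  by rewrite exchange_big -cutE; apply: eq_bigr => x _; apply: eq_bigr => y _; rewrite h_sym.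
have -> : \sum_x u x = \sum_x u' x + c * #|A|%:R.
  rewrite /u' sumrB -mulr_sumr -natr_sum; rewrite (_ : (\sum_i (i \in A))%N = #|A|) ?subrK //.
  by rewrite -sum1_card [RHS]big_mkcond; apply: eq_bigr => x _; case: (x \in A).
have -> : \sum_x \sum_y (h x y)%:R * `|u x - u y| =
   \sum_x \sum_y (h x y)%:R * `|u' x - u' y| +
   c * (2%:R * (\sum_(x in A) \sum_(y in ~: A) h x y)%:R).
  rewrite mulr2n mulrDl mul1r -{1}cutE -cutE' -big_split mulr_sumr -big_split /=.
  apply: eq_bigr => x _; rewrite -big_split mulr_sumr -big_split /=.
  by apply: eq_bigr => y _; rewrite pt; ring.
have ex := expand AU.
rewrite mulrDr; apply: lerD => //.
have -> : 2%:R * phi * (c * #|A|%:R) = c * (2%:R * (phi * #|A|%:R)) by ring.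
by rewrite ler_wpM2l // ler_wpM2l.
Qed.

(** The hard direction of Cheeger's inequality with zero boundary values. [coarea] is applied to the
    square of [f], differences of squares are factored, and Cauchy-Schwarz separates the factors;
    the sums [f x + f y] contribute at most 4 D times the squared norm of [f]. *)
Lemma dirichlet (f : V -> R) : (forall x, x \notin U -> f x = 0) ->
  phi ^+ 2 * \sum_x f x ^+ 2 <= D%:R * \sum_x \sum_y (h x y)%:R * (f x - f y) ^+ 2.
Proof.
move=> fU; set N := \sum_x f x ^+ 2; set S := \sum_x \sum_y _.
have N0 : 0 <= N by apply: sumr_ge0 => x _; rewrite sqr_ge0.
have S0 : 0 <= S.
  by apply: sumr_ge0 => x _; apply: sumr_ge0 => y _; rewrite mulr_ge0 ?sqr_ge0.
have L := @coarea (fun x => f x ^+ 2) (fun x => sqr_ge0 _) _.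
have {}L : 2%:R * phi * N <= \sum_x \sum_y (h x y)%:R * `|f x ^+ 2 - f y ^+ 2|.
  by apply: L => x xU; rewrite fU // expr0n.
pose w (p : V * V) : R := (h p.1 p.2)%:R.
have CS := @cauchy_schwarz R (V * V)%type w (fun p => `|f p.1 - f p.2|)
   (fun p => `|f p.1 + f p.2|) (fun p => ler0n _ _).
have E1 : \sum_p w p * (`|f p.1 - f p.2| * `|f p.1 + f p.2|) =
   \sum_x \sum_y (h x y)%:R * `|f x ^+ 2 - f y ^+ 2|.
  rewrite pair_bigA /=; apply: eq_bigr => p _.
  by rewrite -normrM -subr_sqr.
have E2 : \sum_p w p * `|f p.1 - f p.2| ^+ 2 = S.
  by rewrite /S pair_bigA /=; apply: eq_bigr => p _; rewrite real_normK ?num_real.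
have E3 : \sum_p w p * `|f p.1 + f p.2| ^+ 2 <= 4%:R * D%:R * N.
  have HA : \sum_x \sum_y (h x y)%:R * f x ^+ 2 <= D%:R * N.
    rewrite /N mulr_sumr; apply: ler_sum => x _; rewrite -mulr_suml sum_h.
    by rewrite ler_wpM2r ?sqr_ge0 // ler_nat.
  have HB : \sum_x \sum_y (h x y)%:R * f y ^+ 2 <= D%:R * N.
    rewrite exchange_big /=; apply: le_trans HA; apply: ler_sum => x _.
    by apply: ler_sum => y _; rewrite h_sym.
  apply: le_trans (_ : 2%:R * \sum_x \sum_y (h x y)%:R * f x ^+ 2 +
      2%:R * \sum_x \sum_y (h x y)%:R * f y ^+ 2 <= _); last by lra.
  rewrite !pair_bigA /= !mulr_sumr -big_split /=; apply: ler_sum => p _.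
  rewrite real_normK ?num_real // -/(w p).
  have : 0 <= w p * (f p.1 - f p.2) ^+ 2 by rewrite mulr_ge0 ?sqr_ge0 ?ler0n.
  by rewrite [w p]lock; nra.
rewrite E1 E2 in CS.
have K : (2%:R * phi * N) ^+ 2 <= S * (4%:R * D%:R * N).
  apply: le_trans (_ : (\sum_x \sum_y (h x y)%:R * `|f x ^+ 2 - f y ^+ 2|) ^+ 2 <= _).
    by rewrite lerXn2r ?nnegrE ?mulr_ge0 ?ler0n //; apply: le_trans L; rewrite !mulr_ge0.
  by apply: le_trans CS _; apply: ler_wpM2l.
have [N00|Nn0] := eqVneq N 0; first by rewrite N00 mulr0 mulr_ge0.
have Np : 0 < N by rewrite lt_neqAle eq_sym Nn0.
rewrite -(ler_pM2r Np).
have -> : phi ^+ 2 * N * N = (2%:R * phi * N) ^+ 2 / 4%:R by field.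
have -> : D%:R * S * N = (S * (4%:R * D%:R * N)) / 4%:R by field.
by rewrite ler_wpM2r // invr_ge0.
Qed.

End Cheeger.

Section LazyWalk.
Local Open Scope ring_scope.
Variables (R : realFieldType) (V : finType) (h : rel V) (D : nat).
Hypothesis h_sym : symmetric h.
Hypothesis h_irr : irreflexive h.
Hypothesis D_gt0 : (0 < D)%N.
Hypothesis degD : forall x, (#|[set y | h x y]| <= D)%N.

(** Moving along each arc with the same probability 1 / (2 D), whatever the degree, makes the kernel
    symmetric, so the uniform distribution is stationary; the factor 2 makes the walk lazy. *)
Definition step (x y : V) : R :=
  (h x y)%:R / (2 * D)%:R + (x == y)%:R * (1 - #|[set z | h x z]|%:R / (2 * D)%:R).

Let D2_gt0 : 0 < (2 * D)%:R :> R.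
Proof. by rewrite ltr0n muln_gt0. Qed.

Lemma step_lazy x : 2%:R^-1 <= step x x.
Proof.
rewrite /step h_irr eqxx mul0r add0r mul1r.
have : #|[set z | h x z]|%:R / (2 * D)%:R <= 2%:R^-1 :> R.
  rewrite ler_pdivrMr // natrM mulKf ?pnatr_eq0 //.
  by rewrite ler_nat.
by lra.
Qed.

Lemma step_ge0 x y : 0 <= step x y.
Proof.
have [->|xy] := eqVneq x y; first by apply: le_trans (step_lazy y); rewrite invr_ge0.
by rewrite /step (negbTE xy) mul0r addr0 divr_ge0.
Qed.

Lemma step_sym x y : step x y = step y x.
Proof.
by rewrite /step h_sym eq_sym; case: eqP => [->//|_]; rewrite !mul0r.
Qed.

Lemma step_neq x y : x != y -> step x y = (h x y)%:R / (2 * D)%:R.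
Proof. by move=> xy; rewrite /step (negbTE xy) mul0r addr0. Qed.

Lemma step_sum x : \sum_y step x y = 1.
Proof.
rewrite big_split /= -mulr_suml sum_h (bigD1 x) //= eqxx mul1r big1 ?addr0; last first.
  by move=> y yx; rewrite eq_sym (negbTE yx) mul0r.
by rewrite addrC subrK.
Qed.

Lemma step_avg x c : \sum_y step x y * c = c.
Proof. by rewrite -mulr_suml step_sum mul1r. Qed.

Lemma step_stationary (g : V -> R) : \sum_x \sum_y step x y * g y = \sum_y g y.
Proof.
rewrite exchange_big /=; apply: eq_bigr => y _.
by rewrite -mulr_suml (eq_bigr (step y)) ?step_sum ?mul1r // => x _; rewrite step_sym.
Qed.

(* Laziness bounds the square of the average increment by half its second moment. *)
Lemma step_contract (f : V -> R) x :
  (\sum_y step x y * f y) ^+ 2 <=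
  \sum_y step x y * f y ^+ 2 - 2%:R^-1 * \sum_y step x y * (f x - f y) ^+ 2.
Proof.
pose g y := f y - f x.
(* The increment vanishes when the walk stays, so that term is dropped. The remaining mass is at
   most 1/2, and this gives the factor in Cauchy-Schwarz. *)
pose w y := if y == x then 0 else step x y.
have w0 y : 0 <= w y by rewrite /w; case: ifP => // _; apply: step_ge0.
have S1 c : c = \sum_y step x y * c by rewrite step_avg.
have E1 : \sum_y step x y * f y = f x + \sum_y step x y * g y.
  rewrite [X in X + _]S1 -big_split /=.
  by apply: eq_bigr => y _; rewrite /g; ring.
have E2 : \sum_y step x y * f y ^+ 2 =
    f x ^+ 2 + 2%:R * f x * (\sum_y step x y * g y) + \sum_y step x y * g y ^+ 2.
  rewrite [X in X + _ + _]S1 mulr_sumr -!big_split /=.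
  by apply: eq_bigr => y _; rewrite /g; ring.
have E3 : \sum_y step x y * (f x - f y) ^+ 2 = \sum_y step x y * g y ^+ 2.
  by apply: eq_bigr => y _; rewrite /g -sqrrN opprB.
have E4 : \sum_y step x y * g y = \sum_y w y * (1 * g y).
  apply: eq_bigr => y _; rewrite /w /g mul1r; case: eqP => [->|//].
  by rewrite subrr !mulr0.
have E5 : \sum_y w y * 1 ^+ 2 <= 2%:R^-1.
  have := step_sum x; rewrite (bigD1 x) //= => Es.
  rewrite (bigD1 x) //= {1}/w eqxx mul0r add0r (eq_bigr (step x)); last first.
    by move=> y /negbTE yx; rewrite /w yx expr1n mulr1.
  by have := step_lazy x; lra.
have E6 : \sum_y w y * g y ^+ 2 <= \sum_y step x y * g y ^+ 2.
  apply: ler_sum => y _; rewrite ler_wpM2r ?sqr_ge0 // /w; case: ifP => // _.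
  exact: step_ge0.
have CS := cauchy_schwarz (fun _ => 1) g w0; rewrite -E4 in CS.
have Q0 : 0 <= \sum_y w y * g y ^+ 2.
  by apply: sumr_ge0 => y _; rewrite mulr_ge0 ?sqr_ge0.
have K : (\sum_y step x y * g y) ^+ 2 <= 2%:R^-1 * \sum_y step x y * g y ^+ 2.
  apply: le_trans CS _; apply: le_trans (ler_wpM2r Q0 E5) _.
  by apply: ler_wpM2l => //; rewrite invr_ge0.
rewrite E3 E1 E2; move: K.
set a := \sum_y step x y * g y; set b := \sum_y step x y * g y ^+ 2.
by rewrite sqrrD; lra.
Qed.

(* [walk_mean t F x] is the expectation of F over the list of the t+1 positions of the
   walk started at x. *)
Fixpoint walk_mean (t : nat) (F : seq V -> R) (x : V) : R :=
  if t is t'.+1 then \sum_y step x y * walk_mean t' (fun l => F (x :: l)) y else F [:: x].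

Lemma walk_mean_eq t F G x : F =1 G -> walk_mean t F x = walk_mean t G x.
Proof.
elim: t F G x => [|t IH] F G x FG /=; first exact: FG.
by apply: eq_bigr => y _; congr (_ * _); apply: IH => l.
Qed.

Lemma walk_mean_le t F G x : (forall l, F l <= G l) -> walk_mean t F x <= walk_mean t G x.
Proof.
elim: t F G x => [|t IH] F G x FG //=; apply: ler_sum => y _.
by apply: ler_wpM2l; [apply: step_ge0|apply: IH].
Qed.

Lemma walk_mean_const t c x : walk_mean t (fun _ => c) x = c.
Proof.
elim: t x => [//|t IH] x /=.
under eq_bigr do rewrite IH.
by rewrite -mulr_suml step_sum mul1r.
Qed.

Lemma walk_meanD t F G x : walk_mean t (fun l => F l + G l) x = walk_mean t F x + walk_mean t G x.
Proof.
elim: t F G x => [//|t IH] F G x /=; rewrite -big_split /=.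
by apply: eq_bigr => y _; rewrite IH mulrDr.
Qed.

Lemma walk_meanZ t c F x : walk_mean t (fun l => c * F l) x = c * walk_mean t F x.
Proof.
elim: t F x => [//|t IH] F x /=; rewrite mulr_sumr.
by apply: eq_bigr => y _; rewrite IH mulrCA.
Qed.

(** Summing over all starting points is, up to scaling, a uniform start, which is stationary; hence
    the first [i] positions can be discarded. *)
Lemma walk_mean_drop i t G : \sum_x walk_mean (i + t) (fun l => G (drop i l)) x = \sum_x walk_mean t G x.
Proof.
elim: i => [|i IH]; first by apply: eq_bigr => x _; apply: walk_mean_eq => l; rewrite drop0.
by rewrite addSn /= step_stationary IH.
Qed.

Lemma walk_mean_take t b G x : walk_mean (t + b) (fun l => G (take t.+1 l)) x = walk_mean t G x.
Proof.
elim: t G x => [|t IH] G x /=; last first.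
  by apply: eq_bigr => y _; rewrite (IH (fun l => G (x :: l))).
case: b => [//|b] /=; rewrite (eq_bigr (fun y => step x y * G [:: x])).
  by rewrite -mulr_suml step_sum mul1r.
move=> y _; rewrite (walk_mean_eq _ _ (G := fun _ => G [:: x])) ?walk_mean_const // => l.
by rewrite take0.
Qed.

Lemma walk_mean_has t (S : {set V}) :
  \sum_x walk_mean t (fun l => (has (mem S) l)%:R) x <= (t.+1 * #|S|)%:R.
Proof.
have cS : \sum_x (x \in S)%:R = #|S|%:R :> R.
  rewrite -natr_sum; congr _%:R; rewrite -sum1_card [RHS]big_mkcond.
  by apply: eq_bigr => x _; case: (x \in S).
elim: t => [|t IH].
  by rewrite mul1n -cS; apply: ler_sum => x _ /=; rewrite orbF.
apply: le_trans (_ : \sum_x ((x \in S)%:R +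
   \sum_y step x y * walk_mean t (fun l => (has (mem S) l)%:R) y) <= _).
  apply: ler_sum => x _ /=; rewrite -[X in _ <= X + _](step_avg x) -big_split /=.
  apply: ler_sum => y _; rewrite -mulrDr; apply: ler_wpM2l; first exact: step_ge0.
  rewrite -[X in _ <= X + _](walk_mean_const t _ y) -walk_meanD; apply: walk_mean_le => l.
  by rewrite -natrD ler_nat; case: (x \in S); case: has.
rewrite big_split /= step_stationary cS mulSn natrD.
by apply: lerD.
Qed.

(* A stall of the lazy walk does not count as entering a vertex. *)
Fixpoint enter (v x : V) (l : seq V) : bool :=
  if l is y :: l' then (x != y) && (y == v) || enter v y l' else false.

Fixpoint never_back (x : V) (l : seq V) : bool :=
  ~~ enter x x l && (if l is y :: l' then never_back y l' else true).

Definition enters v (l : seq V) := if l is x :: l' then enter v x l' else false.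
Definition no_return (l : seq V) := if l is x :: l' then never_back x l' else true.

Lemma walk_mean_head t F F' x : (forall l, F (x :: l) <= F' (x :: l)) -> walk_mean t F x <= walk_mean t F' x.
Proof.
case: t => [|t] FF /=; first exact: FF.
apply: ler_sum => y _; apply: ler_wpM2l; first exact: step_ge0.
by apply: walk_mean_le => l.
Qed.

(** A union bound over the steps: a step moves to [v] from another vertex with probability at most 1
    / (2 D). *)
Lemma walk_mean_enters t v x : walk_mean t (fun l => (enters v l)%:R) x <= t%:R / (2 * D)%:R.
Proof.
elim: t x => [|t IH] x /=; first by rewrite mul0r.
apply: le_trans (_ : \sum_y step x y * (((x != y) && (y == v))%:R + t%:R / (2 * D)%:R) <= _).
  apply: ler_sum => y _; apply: ler_wpM2l; first exact: step_ge0.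
  apply: le_trans (_ : walk_mean t (fun l => ((x != y) && (y == v))%:R + (enters v l)%:R) y <= _).
    apply: walk_mean_head => l /=; rewrite -natrD ler_nat.
    by case: (_ && _); case: enter.
  by rewrite walk_meanD walk_mean_const lerD2l.
under eq_bigr do rewrite mulrDr.
rewrite big_split /= -mulr_suml step_sum mul1r -natr1 mulrDl mul1r addrC lerD2l.
rewrite (bigD1 v) //= eqxx andbT big1 ?addr0; last first.
  by move=> y /negbTE ->; rewrite andbF mulr0.
case: (boolP (x != v)) => [xv|_]; last by rewrite mulr0 invr_ge0.
rewrite mulr1 step_neq // -[leRHS]mul1r ler_wpM2r ?invr_ge0 //.
by rewrite lern1 leq_b1.
Qed.

(** A union bound over the positions of the walk, with [walk_mean_enters] applied from each position
    to its own vertex. *)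
Lemma walk_mean_no_return t x : walk_mean t (fun l => (~~ no_return l)%:R) x <= (t ^ 2)%:R / (2 * D)%:R.
Proof.
elim: t x => [|t IH] x /=; first by rewrite divr_ge0.
apply: le_trans (_ : walk_mean t.+1 (fun l => (enters x l)%:R +
   (if l is _ :: l' then (~~ no_return l')%:R else 0)) x <= _).
  apply: (@walk_mean_head t.+1 (fun l => (~~ no_return l)%:R)) => -[|y l] /=; first by rewrite addr0.
  rewrite negb_and negbK -natrD ler_nat.
  by move: ((x != y) && (y == x)) (enter x y l) (never_back y l) => [] [] [].
rewrite walk_meanD; apply: le_trans (lerD (walk_mean_enters _ _ _) (_ : _ <= (t ^ 2)%:R / (2 * D)%:R)) _.
  rewrite /=; apply: le_trans (_ : \sum_y step x y * ((t ^ 2)%:R / (2 * D)%:R) <= _).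
    by apply: ler_sum => y _; apply: ler_wpM2l; [apply: step_ge0|apply: IH].
  by rewrite -mulr_suml step_sum mul1r.
rewrite -mulrDl -natrD ler_wpM2r ?invr_ge0 // ler_nat; lia.
Qed.

Section Avoid.
Variables (Z : {set V}) (phi : R) (q : nat).
Hypothesis phi_ge0 : 0 <= phi.
Hypothesis q_gt0 : (0 < q)%N.
Hypothesis phi_q : 4%:R * D%:R ^+ 2 <= q%:R * phi ^+ 2.
Hypothesis expand : forall A : {set V}, A \subset ~: Z ->
  phi * #|A|%:R <= (\sum_(x in A) \sum_(y in ~: A) h x y)%:R.

Let av t x := walk_mean t (fun l => (~~ has (mem Z) l)%:R) x.

Lemma avoid_supp t x : x \notin ~: Z -> av t x = 0.
Proof.
rewrite inE negbK /av => xZ; case: t => [|t] /=; first by rewrite xZ.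
rewrite big1 // => y _; rewrite (walk_mean_eq _ _ (G := fun _ => 0)) ?walk_mean_const ?mulr0 // => l.
by rewrite xZ.
Qed.

Lemma avoid_rec t x : av t.+1 x = (x \notin Z)%:R * \sum_y step x y * av t y.
Proof.
rewrite /av /= mulr_sumr; apply: eq_bigr => y _; rewrite mulrCA; congr (_ * _); rewrite -walk_meanZ.
by apply: walk_mean_eq => l; rewrite negb_or -mulnb natrM.
Qed.

(** The squared norm of the avoidance probability shrinks by 1 - 1/q per step: [step_contract] gains
    a multiple of the Dirichlet form, and [dirichlet] applies because the function vanishes on [Z].
    The assumption [phi_q] turns the gain into 1/q. *)
Lemma avoid_sq t : \sum_x av t x ^+ 2 <= #|V|%:R * (1 - q%:R^-1) ^+ t.
Proof.
have q1 : 0 <= 1 - q%:R^-1 :> R.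
  by rewrite subr_ge0 invf_le1 ?ler1n ?ltr0n.
elim: t => [|t IH].
  rewrite mulr1 -sum1_card natr_sum; apply: ler_sum => x _ /=.
  by rewrite /av /= orbF; case: (x \in Z); rewrite ?expr1n ?expr0n.
apply: le_trans (_ : (1 - q%:R^-1) * \sum_x av t x ^+ 2 <= _); last first.
  by rewrite exprS mulrCA ler_wpM2l.
have dir := dirichlet h_sym degD phi_ge0 expand (avoid_supp t).
apply: le_trans (_ : \sum_x (\sum_y step x y * av t y ^+ 2 -
    2%:R^-1 * \sum_y step x y * (av t x - av t y) ^+ 2) <= _).
  apply: ler_sum => x _; apply: le_trans (step_contract _ _).
  by rewrite avoid_rec; case: (x \notin Z); rewrite ?mul1r // mul0r expr0n /= sqr_ge0.
rewrite sumrB step_stationary -mulr_sumr.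
have -> : \sum_x \sum_y step x y * (av t x - av t y) ^+ 2 =
   (2 * D)%:R^-1 * \sum_x \sum_y (h x y)%:R * (av t x - av t y) ^+ 2.
  rewrite mulr_sumr; apply: eq_bigr => x _; rewrite mulr_sumr; apply: eq_bigr => y _.
  have [->|xy] := eqVneq x y; first by rewrite subrr expr0n !mulr0.
  by rewrite step_neq //; ring.
rewrite mulrBl mul1r lerD2l lerN2.
move: dir; set S := \sum_x \sum_y _; set N := \sum_x _ => dir.
have N0 : 0 <= N by apply: sumr_ge0 => x _; rewrite sqr_ge0.
have D0 : 0 < D%:R :> R by rewrite ltr0n.
have qq0 : 0 < q%:R :> R by rewrite ltr0n.
have K : 4%:R * D%:R ^+ 2 * N <= q%:R * D%:R * S.
  apply: le_trans (ler_wpM2r N0 phi_q) _.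
  by rewrite -[leLHS]mulrA -[leRHS]mulrA ler_wpM2l // ltW.
rewrite natrM -(ler_pM2l (_ : 0 < 4%:R * D%:R ^+ 2 * q%:R)); last first.
  by rewrite !mulr_gt0 // exprn_gt0.
have -> : 4%:R * D%:R ^+ 2 * q%:R * (q%:R^-1 * N) = 4%:R * D%:R ^+ 2 * N.
  by field; rewrite lt0r_neq0.
have -> : 4%:R * D%:R ^+ 2 * q%:R * (2%:R^-1 * ((2%:R * D%:R)^-1 * S)) = q%:R * D%:R * S.
  by field; rewrite lt0r_neq0.
by [].
Qed.

(** Bernoulli's inequality gives (1 + 1/q)^q >= 2, and the product of (1 - 1/q)^q and (1 + 1/q)^q is
    at most 1. *)
Lemma halving : (1 - q%:R^-1) ^+ q <= 2%:R^-1 :> R.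
Proof.
have qq0 : 0 < q%:R :> R by rewrite ltr0n.
have q1 : 0 <= 1 - q%:R^-1 :> R by rewrite subr_ge0 invf_le1 ?ler1n.
have bern n (x : R) : 0 <= x -> 1 + n%:R * x <= (1 + x) ^+ n.
  move=> x0; elim: n => [|n IH]; first by rewrite mul0r addr0.
  rewrite exprS; apply: le_trans (ler_wpM2l _ IH); last by rewrite addr_ge0.
  have : 0 <= n%:R * x ^+ 2 by rewrite mulr_ge0 ?sqr_ge0.
  by rewrite -natr1; nra.
have two : 2%:R <= (1 + q%:R^-1) ^+ q :> R.
  apply: le_trans (bern q q%:R^-1 _); last by rewrite invr_ge0 ltW.
  by rewrite mulfV ?lt0r_neq0.
have : (1 - q%:R^-1) ^+ q * (1 + q%:R^-1) ^+ q <= 1 :> R.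
  rewrite -exprMn -subr_sqr expr1n exprn_ile1 //.
    by rewrite subr_ge0 expr_le1 // ?invr_ge0 ?(ltW qq0) // invf_le1 // ler1n.
  by rewrite gerBl sqr_ge0.
have := exprn_ge0 q q1.
by nra.
Qed.

(** After [128 * q] steps the squared norm has been halved 128 times, and Cauchy-Schwarz takes the
    square root, which leaves the exponent 64. *)
Lemma avoid_sum : \sum_x av (128 * q) x <= #|V|%:R * (2%:R ^- 64).
Proof.
have q1 : 0 <= 1 - q%:R^-1 :> R.
  by rewrite subr_ge0 invf_le1 ?ler1n ?ltr0n.
have av0 x : 0 <= av (128 * q) x.
  by rewrite -[leLHS](walk_mean_const (128 * q) 0 x); apply: walk_mean_le.
have A : \sum_x av (128 * q) x ^+ 2 <= #|V|%:R * 2%:R ^- 128.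
  apply: le_trans (avoid_sq _) _; apply: ler_wpM2l => //.
  rewrite mulnC exprM -exprVn; apply: lerXn2r; rewrite ?nnegrE ?exprn_ge0 ?invr_ge0 //.
  exact: halving.
have C := @cauchy_schwarz R V (fun _ => 1) (fun _ => 1) (av (128 * q)) (fun _ => ler01).
have {}C : (\sum_x av (128 * q) x) ^+ 2 <= #|V|%:R * \sum_x av (128 * q) x ^+ 2.
  apply: le_trans (le_trans _ C) _.
    by rewrite le_eqVlt; apply/orP; left; apply/eqP; congr (_ ^+ 2); apply: eq_bigr => x _; rewrite !mul1r.
  apply: ler_pM => //.
  - by apply: sumr_ge0 => x _; rewrite mul1r expr1n.
  - by apply: sumr_ge0 => x _; rewrite mul1r sqr_ge0.
  - by rewrite (eq_bigr (fun=> 1)) ?sumr_const // => x _; rewrite mul1r expr1n.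
  - by apply: ler_sum => x _; rewrite mul1r.
rewrite -(ler_pXn2r (_ : (0 < 2)%N)) ?nnegrE ?mulr_ge0 ?invr_ge0 ?exprn_ge0 //; last first.
  exact: sumr_ge0.
apply: le_trans C _; rewrite exprMn -exprVn -exprM.
by rewrite expr2 -mulrA ler_wpM2l // exprVn.
Qed.

End Avoid.
End LazyWalk.

Definition window (V : Type) (T i : nat) (l : seq V) := take T.+1 (drop (i * T.+1) l).

Lemma big_tuple_cons (R : nmodType) (V : finType) (n : nat) (F : n.+1.-tuple V -> R) :
  (\sum_g F g = \sum_x \sum_(g : n.-tuple V) F [tuple of x :: g])%R.
Proof.
rewrite pair_bigA /=.
rewrite (reindex (fun p : V * n.-tuple V => [tuple of p.1 :: p.2])) //=.
exists (fun g => (thead g, [tuple of behead g])) => [[x g]|g] _ /=.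
  by congr (_, _); apply: val_inj.
by rewrite [RHS]tuple_eta; apply: val_inj.
Qed.

Section GadgetWeights.
Local Open Scope ring_scope.
Variables (R : realFieldType) (V : finType) (h : rel V) (D : nat).
Hypothesis h_sym : symmetric h.
Hypothesis h_irr : irreflexive h.
Hypothesis D_gt0 : (0 < D)%N.
Hypothesis degD : forall x, (#|[set y | h x y]| <= D)%N.

Local Notation step := (@step R V h D).
Local Notation walk_mean := (@walk_mean R V h D).

Definition lazy_adj : rel V := fun x y => (x == y) || h x y.

Fixpoint wt (x : V) (l : seq V) : R := if l is y :: l' then step x y * wt y l' else 1.

Lemma wt_ge0 x l : 0 <= wt x l.
Proof. by elim: l x => [|y l IH] x //=; apply: mulr_ge0 => //; apply: step_ge0. Qed.

Lemma wt_path x l : ~~ path lazy_adj x l -> wt x l = 0.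
Proof.
elim: l x => [//|y l IH] x /=; rewrite negb_and negb_or => /orP[/andP[xy hxy]|/IH ->].
  by rewrite step_neq // (negbTE hxy) !mul0r.
by rewrite mulr0.
Qed.

Lemma walk_mean_tuple t F x : walk_mean t F x = \sum_(g : t.-tuple V) wt x g * F (x :: g).
Proof.
elim: t F x => [|t IH] F x /=.
  rewrite (big_pred1 [tuple]) /= ?mul1r // => g; by rewrite [g]tuple0 /= eq_refl.
rewrite big_tuple_cons; apply: eq_bigr => y _; rewrite IH mulr_sumr.
by apply: eq_bigr => g _; rewrite /= mulrA.
Qed.

Definition weight (l : seq V) : R := if l is x :: l' then wt x l' / #|V|%:R else 0.

Lemma weight_sum s (F : seq V -> R) :
  \sum_(g : s.+1.-tuple V) weight g * F g = (\sum_x walk_mean s F x) / #|V|%:R.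
Proof.
rewrite big_tuple_cons mulr_suml; apply: eq_bigr => x _; rewrite walk_mean_tuple mulr_suml.
by apply: eq_bigr => g _; rewrite /= mulrAC.
Qed.

Variables (phi : R) (q : nat).
Hypothesis phi_ge0 : 0 <= phi.
Hypothesis q_gt0 : (0 < q)%N.
Hypothesis phi_q : 4%:R * D%:R ^+ 2 <= q%:R * phi ^+ 2.
Hypothesis V_gt0 : (0 < #|V|)%N.

Let T := (128 * q)%N.
Let M := (3 * T.+1)%N.

(** The weight is the law of the walk from a uniform start. All later arguments about random gadgets
    use only the properties collected here. *)
Lemma gadget_weights : exists mu : M.-tuple V -> R,
  [/\ forall g, 0 <= mu g, \sum_g mu g = 1 & forall g : M.-tuple V, ~~ sorted lazy_adj g -> mu g = 0] /\
  [/\ forall S : {set V}, \sum_g mu g * (has (mem S) g)%:R <= (M * #|S|)%:R / #|V|%:R,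
      \sum_g mu g * (~~ no_return g)%:R <= (M ^ 2)%:R / (2 * D)%:R &
      forall (i : nat) (Z : {set V}), (i < 3)%N ->
        (forall A : {set V}, A \subset ~: Z ->
          phi * #|A|%:R <= (\sum_(x in A) \sum_(y in ~: A) h x y)%:R) ->
        \sum_g mu g * (~~ has (mem Z) (window T i g))%:R <= 2%:R ^- 64].
Proof.
have V0 : 0 < #|V|%:R :> R by rewrite ltr0n.
rewrite /M; have -> : (3 * T.+1)%N = (3 * T + 2).+1 by lia.
exists (fun g => weight g); split; split.
- by move=> g; case: (tval g) => [|x l] //=; rewrite divr_ge0 ?wt_ge0.
- transitivity (\sum_(g : (3 * T + 2).+1.-tuple V) weight g * 1).
    by apply: eq_bigr => g _; rewrite mulr1.
  rewrite (weight_sum _ (fun _ => 1)); under eq_bigr do rewrite walk_mean_const //.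
  by rewrite sumr_const -mulr_natl mulr1 mulfV // lt0r_neq0.
- move=> g; case: (tval g) => [|x l] //= /wt_path ->; by rewrite mul0r.
- move=> S; rewrite (weight_sum _ (fun l => (has (mem S) l)%:R)).
  by rewrite ler_wpM2r ?invr_ge0 //; apply: walk_mean_has.
- rewrite (weight_sum _ (fun l => (~~ no_return l)%:R)) ler_pdivrMr //.
  apply: le_trans (_ : \sum_(x : V) (((3 * T + 2).+1 ^ 2)%:R / (2 * D)%:R) <= _); last first.
    by rewrite sumr_const mulr_natr.
  apply: ler_sum => x _.
  have := @walk_mean_no_return R V h D h_irr D_gt0 degD (3 * T + 2)%N x => H; apply: le_trans H _.
  by rewrite ler_wpM2r ?invr_ge0 // ler_nat leq_exp2r.
move=> i Z i3 expand; rewrite (weight_sum _ (fun l => (~~ has (mem Z) (window T i l))%:R)).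
(* The steps before window [i] are dropped by stationarity and those after it average out, so the
   window is itself a stationary walk of [T] steps. *)
have -> : (3 * T + 2 = i * T.+1 + (T + (3 * T + 2 - i * T.+1 - T)))%N by nia.
rewrite (@walk_mean_drop R V h D h_sym (i * T.+1) _ (fun l => (~~ has (mem Z) (take T.+1 l))%:R)).
rewrite (eq_bigr (fun x => walk_mean T (fun l => (~~ has (mem Z) l)%:R) x)); last first.
  by move=> x _; rewrite (@walk_mean_take R V h D T _ (fun l => (~~ has (mem Z) l)%:R)).
rewrite ler_pdivrMr // [leRHS]mulrC.
exact: (avoid_sum h_sym h_irr D_gt0 degD phi_ge0 q_gt0 phi_q expand).
Qed.

End GadgetWeights.

(** * Chains of gadgets *)

Section Segments.
Variables (V : finType) (h : rel V).

Lemma enter_mem (x y : V) l : x != y -> x \in l -> enter x y l.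
Proof.
elim: l y => [//|z l IH] y xy /=; rewrite inE.
have [<- _|xz /= xl] := eqVneq x z; first by rewrite eq_sym xy.
by rewrite IH ?orbT.
Qed.

Lemma enter_cat (v x : V) l1 l2 : enter v x l1 -> enter v x (l1 ++ l2).
Proof. by elim: l1 x => [//|y l IH] x /= /orP[->//|/IH ->]; rewrite orbT. Qed.

Lemma never_back_catl (x : V) l1 l2 : never_back x (l1 ++ l2) -> never_back x l1.
Proof.
elim: l1 x => [//|y l IH] x; rewrite cat_cons [never_back x (y :: l ++ l2)]/= [never_back x (y :: l)]/=.
case/andP=> nh /IH ->; rewrite andbT; apply: contra nh => H.
exact: (@enter_cat x x (y :: l) l2 H).
Qed.

Lemma no_return_catr (l1 l2 : seq V) : no_return (l1 ++ l2) -> no_return l2.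
Proof.
elim: l1 => [//|x l IH] /= ; case: l IH => [|y l] IH /=; last by case/andP.
by case: l2 {IH} => [//|y l2] /= /andP[].
Qed.

(* Deleting the stalls of a walk that never returns to a vertex it has left
   gives a path. *)
Lemma never_back_path (x : V) l : never_back x l -> path (lazy_adj h) x l ->
  exists p, [/\ path h x p, last x p = last x l, uniq (x :: p) & x :: p =i x :: l].
Proof.
elim: l x => [|y l IH] x; first by exists [::].
rewrite [never_back x _]/= => /andP[nh gy] /= /andP[xy pl].
have [p [hp lp up pl']] := IH y gy pl.
have [E|nxy] := eqVneq x y.
  exists p; rewrite E; split => // z; by rewrite pl' !inE orbA orbb.
exists (y :: p); split => //.
- by rewrite /= hp andbT; move: xy; rewrite /lazy_adj (negbTE nxy).
- have /= -> := up; rewrite andbT pl'; apply: contra nh.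
  rewrite inE (negbTE nxy) /= => xl; by rewrite enter_mem ?orbT.
by move=> z; rewrite !inE; have := pl' z; rewrite !inE => ->.
Qed.

(** A walk from the first window to the last one traverses the whole middle window. The part from
    [a] to [b] inherits the absence of returns, so removing its stalls leaves a path on the same
    vertices. *)
Lemma gadget_segment T (l : seq V) a b :
  size l = 3 * T.+1 -> no_return l -> sorted (lazy_adj h) l ->
  a \in window T 0 l -> b \in window T 2 l ->
  exists p, [/\ path h a p, last a p = b, uniq (a :: p), {subset a :: p <= l} &
    {subset window T 1 l <= a :: p}].
Proof.
move=> sl gl pl; rewrite /window mul0n drop0 => aw bw.
have El : l = take T.+1 l ++ take T.+1 (drop (1 * T.+1) l) ++ drop (2 * T.+1) l.
  rewrite -{1}(cat_take_drop T.+1 l) mul1n; congr (_ ++ _).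
  rewrite -{1}(cat_take_drop T.+1 (drop T.+1 l)) drop_drop; congr (_ ++ drop _ _); lia.
have {}bw : b \in drop (2 * T.+1) l by apply: mem_take bw.
set w1 := take _ (drop (1 * _) _) in El *.
case/splitPr: aw El => u1 u2; case/splitPr: bw => v1 v2 El.
pose m := u2 ++ w1 ++ rcons v1 b.
have {}El : l = u1 ++ a :: (m ++ v2).
  by rewrite {1}El /m -!catA /= cat_rcons.
have gm : never_back a m.
  by move: gl; rewrite El => /no_return_catr; apply: never_back_catl.
have pm : path (lazy_adj h) a m.
  move: pl; rewrite El => /cat_sorted2[_]; rewrite /= cat_path; by case/andP.
have [p [hp lp up pe]] := never_back_path gm pm.
exists p; split => //.
- by rewrite lp /m !last_cat last_rcons.
- move=> z; rewrite pe El => zm; rewrite mem_cat -cat_cons mem_cat zm orbT //.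
by move=> z zw; rewrite pe inE /m !mem_cat zw !orbT.
Qed.

Lemma window_sub T i (l : seq V) : {subset window T i l <= l}.
Proof. by move=> z /mem_take /mem_drop. Qed.

Lemma window_neq0 T i (l : seq V) : size l = 3 * T.+1 -> i < 3 -> exists z, z \in window T i l.
Proof.
move=> sl i3; have : 0 < size (window T i l).
  rewrite size_take size_drop sl; case: ifP => //; nia.
by case: window => [//|z s] _; exists z; rewrite inE eqxx.
Qed.

Variables (T : nat) (I : finType) (w : I -> (3 * T.+1).-tuple V) (J : {set I}).
Hypothesis Jgood : forall i, i \in J -> no_return (w i) /\ sorted (lazy_adj h) (w i).
Hypothesis Jdisj : forall i j v, i \in J -> j \in J -> v \in w i -> v \in w j -> i = j.

Definition arc (i j : I) := has (fun b => has (h b) (window T 0 (w j))) (window T 2 (w i)).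

(** Each gadget is crossed from an entry in its first window to the vertex of its last window that
    carries the arc to the next gadget. The entry [a] is arbitrary, so that in the induction it can
    be the end of the incoming edge; disjointness of the gadgets makes the concatenation a path. *)
Lemma gadget_chain i p a : path arc i p -> uniq (i :: p) -> {subset i :: p <= J} ->
  a \in window T 0 (w i) ->
  exists X : seq V, [/\ path h a X, uniq (a :: X),
    forall v, v \in a :: X -> exists2 j, j \in i :: p & v \in w j,
    forall j v, j \in i :: p -> v \in window T 1 (w j) -> v \in a :: X &
    size (a :: X) <= size (i :: p) * (3 * T.+1)].
Proof.
have bound j (x : V) q : uniq (x :: q) -> {subset x :: q <= w j} -> size (x :: q) <= 3 * T.+1.
  by move=> uq sub; rewrite -[leqRHS](size_tuple (w j)); apply: uniq_leq_size.
elim: p i a => [|j p IH] i a pp up pJ aw.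
  have iJ : i \in J by apply: pJ; rewrite inE eqxx.
  have [gi si] := Jgood iJ.
  have [b bw] := @window_neq0 T 2 (w i) (size_tuple _) isT.
  have [q [hq lq uq qw wq]] := gadget_segment (size_tuple _) gi si aw bw.
  exists q; split => //.
  - by move=> v /qw vw; exists i => //; rewrite inE.
  - by move=> j v; rewrite mem_seq1 => /eqP-> /wq.
  - by rewrite mul1n; apply: bound qw.
move: pp => /= /andP[/hasP[b bw /hasP[a' a'w ba']] pp].
have iJ : i \in J by apply: pJ; rewrite inE eqxx.
have [gi si] := Jgood iJ.
have [q [hq lq uq qw wq]] := gadget_segment (size_tuple _) gi si aw bw.
have pJ' : {subset j :: p <= J} by move=> z zp; apply: pJ; rewrite inE zp orbT.
move: up; rewrite cons_uniq => /andP[ip up'].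
have [X [hX uX Xw wX sX]] := IH j a' pp up' pJ' a'w.
have uqX : uniq ((a :: q) ++ a' :: X).
  rewrite cat_uniq uq uX andbT; apply/hasPn => v /Xw[j' j'p vj'].
  apply/negP => /qw vi; move: ip.
  by rewrite (Jdisj iJ _ vi vj') ?j'p //; apply: pJ'.
have szX : size ((a :: q) ++ a' :: X) <= size (i :: j :: p) * (3 * T.+1).
  rewrite size_cat [size (i :: _)]/= mulSn; apply: leq_add => //.
  by apply: bound qw.
exists (q ++ a' :: X); split => //.
- by rewrite cat_path hq /= lq ba'.
- move=> v; rewrite -cat_cons mem_cat => /orP[/qw vi|/Xw[j' j'p vj']].
    by exists i => //; rewrite inE eqxx.
  by exists j' => //; rewrite inE j'p orbT.
- move=> j' v; rewrite -cat_cons mem_cat [j' \in _]in_cons => /orP[/eqP->/wq->//|j'p vw].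
  by rewrite (wX j') ?orbT.
Qed.

(** Choosing for each gadget of [S] one of its vertices in [B] is injective, as the gadgets are
    disjoint. *)
Lemma card_transversal (S : {set I}) (B : {set V}) : S \subset J ->
  (forall i, i \in S -> exists2 v, v \in B & v \in w i) -> #|S| <= #|B|.
Proof.
move=> SJ H; pose g i := [pick v in B | v \in w i].
have gP i : i \in S -> exists v, [/\ g i = Some v, v \in B & v \in w i].
  move=> iS; rewrite /g; case: pickP => [v /andP[vB vw]|none]; first by exists v.
  by have [v vB vw] := H i iS; have := none v; rewrite /= vB vw.
have g_inj : {in S &, injective g}.
  move=> i j iS jS; have [v [-> _ vi]] := gP i iS; have [v' [-> _ vj]] := gP j jS.
  by case=> E; apply: (Jdisj (subsetP SJ i iS) (subsetP SJ j jS) vi); rewrite E.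
rewrite -(card_in_imset g_inj) -[leqRHS](card_imset (mem B) (@Some_inj _)); apply: subset_leq_card.
apply/subsetP => _ /imsetP[i iS ->]; have [v [-> vB _]] := gP i iS.
exact: imset_f.
Qed.

End Segments.

(** * A random family of gadgets *)

Definition below (N : nat) (F : {set 'I_N}) (i : nat) : {set 'I_N} :=
  [set j in F | j < i].

(** In use, [nb i] is the set of neighbours of one window of the gadget [i], so a full vertex sends
    edges to at least [k] gadgets of [F]. *)
Definition full (V : finType) (N k : nat) (nb : 'I_N -> {set V}) (F : {set 'I_N}) : {set V} :=
  [set v | k <= #|[set i in F | v \in nb i]|].

(** All elements of the set other than its largest one, [i], lie below [i] in [A], and there are
    fewer than [k] of those. *)
Lemma card_low_rank (N k : nat) (A : {set 'I_N}) :
  #|[set i in A | #|below A i| < k]| <= k.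
Proof.
set B := [set i in A | _].
have [->|[x xB]] := set_0Vmem B; first by rewrite cards0.
case: (@arg_maxnP _ x (fun i => i \in B) (fun i => nat_of_ord i) xB) => i iB imax.
move: (iB); rewrite inE => /andP[iA ik]; apply: leq_trans ik.
apply: leq_trans (_ : #|i |: below A i| <= _); last first.
  by rewrite cardsU1; case: (_ \notin _).
apply: subset_leq_card; apply/subsetP => j jB; rewrite !inE.
have le : j <= i := imax j jB.
move: jB; rewrite inE => /andP[jA _]; rewrite jA /=.
by move: le; rewrite leq_eqVlt => /orP[/eqP/val_inj->|->]; rewrite ?eqxx ?orbT.
Qed.

Lemma card_sumb (T : finType) (A : {set T}) : #|A| = \sum_x nat_of_bool (x \in A).
Proof.
by rewrite -sum1_card big_mkcond; apply: eq_bigr => x _; case: (x \in A).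
Qed.

Lemma card_all_sets (T : finType) : #|{set T}| = 2 ^ #|T|.
Proof. by rewrite -(cardsT T) -card_powerset powersetT cardsT. Qed.

(* A vertex v stops being counted once it is full, so it is counted at most k times. *)
Lemma full_budget (V : finType) (N k : nat) (nb : 'I_N -> {set V}) (F : {set 'I_N}) :
  \sum_(i in F) #|nb i :\: full k nb (below F i)| <= k * #|V|.
Proof.
under eq_bigr do rewrite card_sumb.
rewrite exchange_big /= mulnC -sum_nat_const; apply: leq_sum => v _.
apply: leq_trans (card_low_rank k [set i in F | v \in nb i]).
rewrite card_sumb [leqLHS]big_mkcond /=; apply: leq_sum => i _.
rewrite !inE; case: (i \in F) => //=; case: (v \in nb i); rewrite ?andbF // andbT -ltnNge.
rewrite (_ : below [set i0 in F | v \in nb i0] i = [set i0 in below F i | v \in nb i0]) //.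
by apply/setP => j; rewrite !inE -!andbA [X in _ && X]andbC.
Qed.

Lemma full_eq (V : finType) (N k : nat) (nb nb' : 'I_N -> {set V}) (F : {set 'I_N}) :
  (forall i, i \in F -> nb i = nb' i) -> full k nb F = full k nb' F.
Proof.
move=> E; apply/setP => v; rewrite !inE; congr (_ <= #|pred_of_set _|).
by apply/setP => i; rewrite !inE; case: (boolP (i \in F)) => //= /E ->.
Qed.

Lemma full_sub (V : finType) (N k : nat) (nb : 'I_N -> {set V}) (F F' : {set 'I_N}) :
  F \subset F' -> full k nb F \subset full k nb F'.
Proof.
move=> sub; apply/subsetP => v; rewrite !inE => H; apply: leq_trans H _.
apply: subset_leq_card; apply/subsetP => i; rewrite !inE => /andP[iF ->].
by rewrite (subsetP sub).
Qed.


Section RandomFamily.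
Local Open Scope ring_scope.
Variables (R : realFieldType) (V : finType) (h : rel V) (D T m k d0 : nat).
Local Notation M := (3 * T.+1)%N.
Local Notation N := (8 * m)%N.
Variable mu : M.-tuple V -> R.
Hypothesis mu_ge0 : forall g, 0 <= mu g.
Hypothesis mu_sum : \sum_g mu g = 1.
Hypothesis mu_walk : forall g : M.-tuple V, ~~ sorted (lazy_adj h) g -> mu g = 0.
Hypothesis mu_hit : forall S : {set V},
  \sum_g mu g * (has (mem S) g)%:R <= (M * #|S|)%:R / #|V|%:R.
Hypothesis mu_good : \sum_g mu g * (~~ no_return g)%:R <= (M ^ 2)%:R / (2 * D)%:R.
Hypothesis mu_window : forall (i : nat) (Z : {set V}), (i < 3)%N -> (#|V| <= 120 * #|Z|)%N ->
  \sum_g mu g * (~~ has (mem Z) (window T i g))%:R <= 2%:R ^- 64.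
Hypothesis fresh_large : forall W : {set V}, (120 * #|W| < #|V|)%N ->
  (#|V| <= 120 * #|[set a | (d0 <= #|[set v | h v a] :\: W|)%N]|)%N.
Hypothesis m_gt0 : (0 < m)%N.
Hypothesis V_gt0 : (0 < #|V|)%N.
Hypothesis m_small : (128 * m * M ^ 2 <= #|V|)%N.
Hypothesis D_large : (8 * M ^ 2 <= D)%N.
Hypothesis budget : (2 * (k * #|V|) < m * d0)%N.

Definition nbr (i : nat) (g : seq V) : {set V} := [set v | has (h v) (window T i g)].
Definition fresh (W : {set V}) : {set V} := [set a | (d0 <= #|[set v | h v a] :\: W|)%N].

Local Notation Om := {ffun 'I_N -> M.-tuple V}.
Local Notation fullw a w := (full k (fun i => nbr a (w i))).
Local Notation E F := (\sum_(w : Om) prodw mu w * F w).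

(** While few vertices are full, a gadget makes progress when its window meets a vertex with at
    least [d0] neighbours that the earlier gadgets of [F] have not filled; this is the event that it
    makes none. *)
Definition fail1 a (F : {set 'I_N}) (i : 'I_N) (w : Om) :=
  (120 * #|fullw a w (below F i)| < #|V|)%N &&
  ~~ has (mem (fresh (fullw a w (below F i)))) (window T a (w i)).

(** Many vertices are full with respect to [F], and yet the window [b] of the gadget misses all of
    them. *)
Definition fail2 a b (F : {set 'I_N}) (i : 'I_N) (w : Om) :=
  (#|V| <= 120 * #|fullw a w F|)%N && ~~ has (mem (fullw a w F)) (window T b (w i)).

Lemma full_upd a (w : Om) (j : 'I_N) g (G : {set 'I_N}) : j \notin G ->
  fullw a (upd w j g) G = fullw a w G.
Proof.
move=> jG; apply: full_eq => i iG; rewrite /upd ffunE.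
by case: eqP iG jG => [->->|].
Qed.

Let eta : R := 2%:R ^- 64.
Let eta_ge0 : 0 <= eta. Proof. by rewrite invr_ge0 exprn_ge0. Qed.

(** The target set of gadget [i] depends only on gadgets of smaller index, so it is fixed when [i]
    is resampled, and the event does not change when a later gadget is. *)
Lemma fail1_prob a (F S : {set 'I_N}) : (a < 3)%N ->
  E (fun w => [forall i in S, fail1 a F i w]%:R) <= eta ^+ #|S|.
Proof.
move=> a3; apply: all_fail_le => //.
- move=> i w _; have ni : i \notin below F i by rewrite inE ltnn andbF.
  under eq_bigr => g _ do rewrite /fail1 (full_upd a w g ni) ffunE eqxx.
  case: (boolP (_ < _)%N) => [small|_] /=; last by rewrite big1 // => g _; rewrite mulr0.
  by apply: mu_window => //; apply: fresh_large.
- move=> i j w g _ _ ij; rewrite /fail1 full_upd; last first.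
    by rewrite inE ltnNge (ltnW ij) andbF.
  by rewrite ffunE ifN // neq_ltn ij.
Qed.

(** The target set depends only on the gadgets of [F], none of which lies in [S]. *)
Lemma fail2_prob a b (F S : {set 'I_N}) : (b < 3)%N -> [disjoint F & S] ->
  E (fun w => [forall i in S, fail2 a b F i w]%:R) <= eta ^+ #|S|.
Proof.
move=> b3 dFS; have out i : i \in S -> i \notin F.
  by move=> iS; apply/negP => iF; move/pred0P: dFS => /(_ i) /=; rewrite iF iS.
apply: all_fail_le => //.
- move=> i w /out iF.
  under eq_bigr => g _ do rewrite /fail2 (full_upd a w g iF) ffunE eqxx.
  case: (boolP (_ <= _)%N) => [large|_] /=; last by rewrite big1 // => g _; rewrite mulr0.
  exact: mu_window.
- move=> i j w g _ /out jF ij; rewrite /fail2 full_upd //.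
  by rewrite ffunE ifN // neq_ltn ij.
Qed.

Definition num_fail (w : Om) : nat :=
  \sum_(p : {set 'I_N} * {set 'I_N} | (m <= 2 * #|p.2|)%N)
    ([forall i in p.2, fail1 1 p.1 i w] + [forall i in p.2, fail1 2 p.1 i w] +
     ([disjoint p.1 & p.2] && [forall i in p.2, fail2 2 0 p.1 i w]) +
     ([disjoint p.1 & p.2] && [forall i in p.2, fail2 1 1 p.1 i w])).

(** The union bound: there are at most 2^(16 m) pairs of sets, and since [S] has at least m/2
    gadgets, each of the four events for a pair has probability at most 2^(-64 m/2) = 2^(-32 m). *)
Lemma num_fail_mean : E (fun w => (num_fail w)%:R) <= 4%:R^-1.
Proof.
under eq_bigr do rewrite /num_fail natr_sum mulr_sumr.
rewrite exchange_big /=.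
apply: le_trans (_ : \sum_(p : {set 'I_N} * {set 'I_N}) 4%:R * 2%:R ^- (32 * m) <= _).
  rewrite big_mkcond; apply: ler_sum => -[F S] _ /=.
  case: ifP => mS; last by rewrite mulr_ge0 // invr_ge0 exprn_ge0.
  have etaS : eta ^+ #|S| <= 2%:R ^- (32 * m).
    rewrite /eta exprVn -exprM lef_pV2 ?posrE ?exprn_gt0 //.
    rewrite ler_eXn2l ?ltr1n // . by have := mS; rewrite -(leq_pmul2l (isT : 0 < 32)%N) mulnA.
  under eq_bigr do rewrite !natrD !mulrDr.
  rewrite !big_split /=.
  have A a : (a < 3)%N -> E (fun w => [forall i in S, fail1 a F i w]%:R) <= 2%:R ^- (32 * m).
    by move=> a3; apply: le_trans etaS; apply: fail1_prob.
  have B a b : (b < 3)%N ->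
      E (fun w => ([disjoint F & S] && [forall i in S, fail2 a b F i w])%:R) <= 2%:R ^- (32 * m).
    move=> b3; case: (boolP [disjoint F & S]) => dFS /=.
      by apply: le_trans etaS; apply: fail2_prob.
    by rewrite big1 ?invr_ge0 ?exprn_ge0 // => w _; rewrite mulr0.
  apply: le_trans (lerD (lerD (lerD (A 1%N isT) (A 2%N isT)) (B 2%N 0%N isT)) (B 1%N 1%N isT)) _.
  by set c := _ ^- _; lra.
rewrite sumr_const card_prod card_all_sets card_ord -expnD -[leLHS]mulr_natl natrX.
have -> : (8 * m + 8 * m = 16 * m)%N by lia.
have -> : (32 * m = 16 * m + 16 * m)%N by lia.
set y := 2%:R ^+ (16 * m) : R.
have y16 : 16%:R <= y by rewrite /y -natrX ler_nat (@leq_pexp2l 2 4) //; lia.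
have y0 : 0 < y by apply: lt_le_trans y16.
have -> : y * (4%:R * 2%:R ^- (16 * m + 16 * m)) = 4%:R / y.
  by rewrite exprD -/y; field; rewrite lt0r_neq0.
by rewrite ler_pdivrMr //; lra.
Qed.

Definition meet (w : Om) (i j : 'I_N) := has (mem [set v | v \in w j]) (w i).

Definition num_bad (w : Om) : nat :=
  \sum_i (~~ no_return (w i) + ~~ sorted (lazy_adj h) (w i) + \sum_(j | j != i) meet w i j)%N.

Lemma E_coord (i : 'I_N) (F : M.-tuple V -> R) : E (fun w : Om => F (w i)) = \sum_g mu g * F g.
Proof.
rewrite (resample mu_sum i).
rewrite (eq_bigr (fun w => prodw mu w * \sum_g mu g * F g)).
  by rewrite -mulr_suml (prodw_sum mu_sum) mul1r.
by move=> w _; congr (_ * _); apply: eq_bigr => g _; rewrite ffunE eqxx.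
Qed.

(** Each of the 8 m gadgets contributes at most 1/8: at most 1/16 for returns, by [D_large]; nothing
    for sequences that are not walks; at most 1/16 for meeting one of the other gadgets, by
    [m_small]. *)
Lemma num_bad_mean : E (fun w => (num_bad w)%:R) <= m%:R.
Proof.
under eq_bigr do rewrite /num_bad natr_sum mulr_sumr.
rewrite exchange_big /=.
have n0 : 0 < #|V|%:R :> R by rewrite ltr0n.
have M0 : 0 < (M ^ 2)%:R :> R by rewrite ltr0n.
apply: le_trans (_ : \sum_(i < N) (8%:R^-1) <= _); last first.
  by rewrite sumr_const card_ord -[leLHS]mulr_natr natrM mulKf ?pnatr_eq0.
apply: ler_sum => i _.
under eq_bigr do rewrite !natrD !mulrDr natr_sum mulr_sumr.
rewrite !big_split /=.
have A1 : E (fun w : Om => (~~ no_return (w i))%:R) <= 16%:R^-1.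
  rewrite (E_coord i (fun g => (~~ no_return g)%:R)); apply: le_trans mu_good _.
  have D0 : 0 < (2 * D)%:R :> R by rewrite ltr0n; lia.
  rewrite ler_pdivrMr // ler_pdivlMl // -natrM ler_nat; lia.
have A2 : E (fun w : Om => (~~ sorted (lazy_adj h) (w i))%:R) = 0.
  rewrite (E_coord i (fun g => (~~ sorted (lazy_adj h) g)%:R)) big1 // => g _.
  by case: (boolP (sorted _ _)) => [_|/mu_walk ->]; rewrite ?mulr0 ?mul0r.
have A3 : \sum_(w : Om) \sum_(j | j != i) prodw mu w * (meet w i j)%:R <= 16%:R^-1.
  rewrite exchange_big /=.
  apply: le_trans (_ : \sum_(j | j != i) (M ^ 2)%:R / #|V|%:R <= _).
    apply: ler_sum => j ji; rewrite (resample mu_sum i).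
    apply: le_trans (_ : \sum_(w : Om) prodw mu w * ((M ^ 2)%:R / #|V|%:R) <= _); last first.
      by rewrite -mulr_suml (prodw_sum mu_sum) mul1r.
    apply: ler_sum => w _; apply: ler_wpM2l; first exact: prodw_ge0.
    rewrite /meet.
    under eq_bigr => g _ do rewrite !ffunE eqxx (negbTE ji).
    apply: le_trans (mu_hit _) _; apply: ler_wpM2r; first by rewrite invr_ge0 ltW.
    rewrite ler_nat expnS expn1 leq_mul2l /=.
    have := card_size (w j); rewrite size_tuple; apply: leq_trans.
    by apply: subset_leq_card; apply/subsetP => v; rewrite inE.
  apply: le_trans (_ : \sum_(j < N) ((M ^ 2)%:R / #|V|%:R) <= _).
    by rewrite big_mkcond; apply: ler_sum => j _; case: ifP => // _; rewrite divr_ge0.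
  rewrite sumr_const card_ord -[leLHS]mulr_natl mulrA ler_pdivrMr // ler_pdivlMl // -!natrM ler_nat.
  lia.
rewrite A2 addr0; apply: le_trans (lerD A1 A3) _; lra.
Qed.

Lemma good_family : exists (w : Om) (J : {set 'I_N}),
  [/\ (4 * m <= #|J|)%N,
      forall i, i \in J -> no_return (w i) /\ sorted (lazy_adj h) (w i),
      forall i j v, i \in J -> j \in J -> v \in w i -> v \in w j -> i = j &
      forall a b (F U : {set 'I_N}), (a, b) \in [:: (2, 0); (1, 1)]%N ->
        #|F| = m -> #|U| = m -> [disjoint F & U] ->
        (m <= 2 * #|[set i in U | has (mem (fullw a w F)) (window T b (w i))]|)%N].
Proof.
have m0 : 0 < m%:R :> R by rewrite ltr0n.
(* The mean of this quantity is at most 1/4 + 1/2. A value below 1 means that no failure event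
   occurs and that fewer than 2 m gadgets are bad. *)
have [|w Fw] := @prodw_exists R _ mu mu_ge0 mu_sum _
  (fun w : Om => (num_fail w)%:R + (num_bad w)%:R * (2 * m)%:R^-1).
  under eq_bigr do rewrite mulrDr mulrA.
  rewrite big_split /= -mulr_suml.
  have m2 : 0 <= (2 * m)%:R^-1 :> R by rewrite invr_ge0.
  apply: le_lt_trans (lerD num_fail_mean (ler_wpM2r m2 num_bad_mean)) _.
  rewrite natrM invfM mulrCA mulfV ?lt0r_neq0 //; lra.
have nf0 : num_fail w = 0%N.
  apply/eqP; rewrite -leqn0 -ltnS -(ltr_nat R); apply: le_lt_trans Fw.
  by rewrite lerDl mulr_ge0 // invr_ge0.
have nb : (num_bad w < 2 * m)%N.
  rewrite -(ltr_nat R) -[ltRHS]mul1r -ltr_pdivrMr ?ltr0n ?muln_gt0 //.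
  by apply: le_lt_trans Fw; rewrite lerDr.
pose bad i := (~~ no_return (w i) + ~~ sorted (lazy_adj h) (w i) + \sum_(j | j != i) meet w i j)%N.
pose J := [set i | bad i == 0%N].
have JP i : i \in J -> [/\ no_return (w i), sorted (lazy_adj h) (w i) &
    forall j, j != i -> ~~ meet w i j].
  rewrite inE /bad !addn_eq0 !eqb0 !negbK => /andP[/andP[-> ->]].
  rewrite sum_nat_eq0 => /forallP H; split => // j ji.
  by have := H j; rewrite ji /= eqb0.
exists w, J; split.
- have : (#|~: J| <= num_bad w)%N.
    rewrite card_sumb; apply: leq_sum => i _; rewrite !inE -/(bad i).
    by case: (bad i).
  move: (cardsC J); rewrite card_ord => H1 H2; have := leq_ltn_trans H2 nb.
  by move: #|J| #|~: J| H1 => x y; lia.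
- by move=> i /JP[].
- move=> i j v /JP[_ _ H] jJ vi vj; apply/eqP; apply: contraT => ij.
  have ji : j != i by rewrite eq_sym.
  by move: (H j ji); apply: contraNT => _; apply/hasP; exists v; rewrite ?inE.
move=> a b F U ab Fm Um dFU.
have nofail (F' S : {set 'I_N}) : (m <= 2 * #|S|)%N ->
   [/\ ~~ [forall i in S, fail1 1 F' i w], ~~ [forall i in S, fail1 2 F' i w],
     [disjoint F' & S] -> ~~ [forall i in S, fail2 2 0 F' i w] &
     [disjoint F' & S] -> ~~ [forall i in S, fail2 1 1 F' i w]].
  move=> mS; move/eqP: nf0; rewrite /num_fail sum_nat_eq0 => /forallP /(_ (F', S)).
  rewrite /= mS /= !addn_eq0 !eqb0 => /andP[/andP[/andP[-> ->]] h3 h4].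
  by split => // d; [move: h3|move: h4]; rewrite d.
have a3 : (a < 3)%N by move: ab; rewrite !inE => /orP[]/eqP[-> _].
have n1 (S : {set 'I_N}) : (m <= 2 * #|S|)%N -> ~~ [forall i in S, fail1 a F i w].
  by move=> /(nofail F)[]; move: ab; rewrite !inE => /orP[]/eqP[-> _].
have n2 (S : {set 'I_N}) : (m <= 2 * #|S|)%N -> [disjoint F & S] ->
    ~~ [forall i in S, fail2 a b F i w].
  by move=> /(nofail F)[_ _]; move: ab; rewrite !inE => /orP[]/eqP[-> ->] ? ? ?; auto.
(* Otherwise more than half of the gadgets of [F] make progress, each adding at least [d0] to the
   sum in [full_budget], whose total would exceed [k * #|V|] by [budget]. *)
have large : (#|V| <= 120 * #|fullw a w F|)%N.
  rewrite leqNgt; apply/negP => small.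
  pose F' := [set i in F | fail1 a F i w].
  have F'm : (2 * #|F'| < m)%N.
    rewrite ltnNge; apply: (contraL (@n1 F')); apply/forallP => i; apply/implyP.
    by rewrite inE => /andP[].
  have cF : (#|F :\: F'| + #|F'| = m)%N.
    apply: etrans Fm; rewrite -(cardsID F' F) addnC; congr (#|pred_of_set _| + _)%N.
    by apply/esym/setIidPr/subsetP => i; rewrite inE => /andP[].
  have := full_budget k (fun i => nbr a (w i)) F; rewrite leqNgt => /negP[].
  apply: leq_trans (_ : d0 * #|F :\: F'| <= _)%N; first by nia.
  rewrite mulnC -sum_nat_const big_mkcond [leqRHS]big_mkcond /=.
  apply: leq_sum => i _; rewrite !inE; case: (boolP (i \in F)) => iF; rewrite ?andbF //= andbT.
  case: ifP => //; rewrite /fail1.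
  have sub : below F i \subset F by apply/subsetP => j; rewrite inE => /andP[].
  have -> /= : (120 * #|fullw a w (below F i)| < #|V|)%N.
    apply: leq_ltn_trans small; rewrite leq_mul2l /=.
    exact: subset_leq_card (full_sub _ _ sub).
  rewrite negbK => /hasP[x xw]; rewrite !inE => dx; apply: leq_trans dx _.
  apply: subset_leq_card; apply: setSD; apply/subsetP => v; rewrite !inE => vx.
  by apply/hasP; exists x.
pose U' := [set i in U | fail2 a b F i w].
have U'm : (2 * #|U'| < m)%N.
  rewrite ltnNge; apply/negP => /n2 H.
  have /H/negP[] : [disjoint F & U'].
    by apply: disjointWr dFU; apply/subsetP => i; rewrite inE => /andP[].
  by apply/forallP => i; apply/implyP; rewrite inE => /andP[].
have : (#|U| <= #|U'| + #|[set i in U | has (mem (fullw a w F)) (window T b (w i))]|)%N.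
  apply: leq_trans (leq_card_setU _ _).1; apply: subset_leq_card.
  apply/subsetP => i iU; rewrite !inE iU /fail2 large /=; by case: has.
by move: #|U| #|U'| #|[set i in U | _]| Um U'm => x y z; lia.
Qed.

End RandomFamily.

(** * Two dense paths in an expander *)

Lemma exists_subset_card (T : finType) (A : {set T}) (m : nat) :
  m <= #|A| -> exists2 B : {set T}, B \subset A & #|B| = m.
Proof.
move=> mA; exists [set x in take m (enum A)].
  by apply/subsetP => x; rewrite inE => /mem_take; rewrite mem_enum.
rewrite cardsE; have /card_uniqP -> : uniq (take m (enum A)) by rewrite take_uniq ?enum_uniq.
by rewrite size_take -cardE; case: ltngtP mA.
Qed.

Lemma conductance_ratio (R : realFieldType) (a b c D q : nat) : 0 < c ->
  a * D ^ 2 * c ^ 2 <= q * b ^ 2 ->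
  (a%:R * D%:R ^+ 2 <= q%:R * (b%:R / c%:R) ^+ 2 :> R)%R.
Proof.
move=> c0; rewrite -(ler_nat R).
have -> : (a * D ^ 2 * c ^ 2)%:R%R = (a%:R * D%:R ^+ 2 * c%:R ^+ 2)%R :> R by rewrite -!natrX -!natrM.
have -> : (q * b ^ 2)%:R%R = (q%:R * b%:R ^+ 2)%R :> R by rewrite -natrX -natrM.
move=> H.
by rewrite expr_div_n [leRHS]mulrA ler_pdivlMr // exprn_gt0 // ltr0n.
Qed.

Lemma half_gt0 m x : 0 < m -> m <= 2 * x -> 0 < x.
Proof. lia. Qed.

Lemma long_path_size m j s : 4 * m <= j -> j < s + 2 * m -> 2 * m < s.
Proof. lia. Qed.

Lemma min_expand a a' z n : z <= a' -> n <= 120 * z -> a <= n -> a <= minn a a' * 120.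
Proof. lia. Qed.

Lemma paths_vs_edges x y m M : x <= m * M -> y <= m * M -> 0 < m -> 0 < M ->
  512 * (x + y + 2) * 2 <= 4096 * M * m.
Proof. nia. Qed.

Lemma budget_arith c m M n d0 : n <= m * (256 * M ^ 2) -> 0 < m ->
  2 * (c * 256) * M ^ 3 < d0 -> 2 * (c * M * n) < m * d0.
Proof.
move=> nm m0 H; apply: leq_ltn_trans (_ : m * (2 * (c * 256) * M ^ 3) < _).
  apply: leq_trans (_ : 2 * (c * M * (m * (256 * M ^ 2))) <= _).
    by rewrite leq_mul2l /= leq_mul2l nm orbT.
  by rewrite (expnS M 2); apply: eq_leq; ring.
by rewrite ltn_pmul2l.
Qed.

Lemma trunc_double n x : 0 < x -> 0 < n %/ x -> n <= n %/ x * (2 * x).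
Proof. move=> x0; have := ltn_ceil n x0; nia. Qed.

Lemma half_large c y : 2 * c + 4 <= y -> c < y %/ 2.
Proof. lia. Qed.

Lemma square_le_cube c M y : c <= 4096 -> 0 < M ->
  2 * (2 * (4096 * 256) * M ^ 3) + 4 <= y -> c * M ^ 2 <= y.
Proof.
move=> c4 M0; have := leq_mul c4 (leq_pexp2l M0 (isT : 2 <= 3)).
by move: (c * M ^ 2) (M ^ 3) => u v; lia.
Qed.

Section Expander.
Variables (V : finType) (h : rel V) (b l q : nat).
Hypothesis h_sym : symmetric h.
Hypothesis h_irr : irreflexive h.
Hypothesis deg_le : forall x, #|[set y | h x y]| <= 60 * (b * l).
Hypothesis deg_sum : 2 * (b * l) * #|V| <= \sum_x #|[set y | h x y]|.
Hypothesis expand : forall A : {set V},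
  b * minn #|A| #|~: A| <= \sum_(x in A) \sum_(y in ~: A) h x y.
Hypothesis V_gt0 : 0 < #|V|.

(** Of the at least 2 b l |V| arcs, those from [W] number at most b l |V| / 2, and so do those into
    vertices with fewer than [d0] neighbours outside [W]. The remaining b l |V| arcs end in the set
    of the conclusion, where each vertex takes at most 60 b l. *)
Lemma fresh_card (d0 : nat) (W : {set V}) : 0 < b * l -> 2 * d0 <= b * l ->
  120 * #|W| < #|V| -> #|V| <= 120 * #|[set a | d0 <= #|[set v | h v a] :\: W|]|.
Proof.
move=> bl0 d0bl Wn; set Z := [set a | _].
have S1 : \sum_a #|[set v | h v a] :\: W| = \sum_(v | v \notin W) #|[set y | h v y]|.
  under eq_bigr do rewrite card_sumb.
  rewrite exchange_big /= [RHS]big_mkcond; apply: eq_bigr => v _ /=.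
  case: (boolP (v \in W)) => vW /=; first by rewrite big1 // => a _; rewrite !inE vW.
  by rewrite card_sumb; apply: eq_bigr => a _; rewrite !inE vW.
have S2 : \sum_x #|[set y | h x y]| <=
    \sum_(v | v \notin W) #|[set y | h v y]| + 60 * (b * l) * #|W|.
  rewrite (bigID (fun v => v \in W)) /= addnC leq_add2l mulnC -sum_nat_const.
  by apply: leq_sum => v _; apply: deg_le.
have S3 : \sum_a #|[set v | h v a] :\: W| <= 60 * (b * l) * #|Z| + d0 * #|V|.
  apply: leq_trans (_ : \sum_a (60 * (b * l) * (a \in Z) + d0) <= _).
    apply: leq_sum => a _; case: (boolP (a \in Z)) => aZ.
      rewrite muln1; apply: leq_trans (leq_addr _ _).
      apply: leq_trans (deg_le a); apply: subset_leq_card.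
      by apply/subsetP => v; rewrite !inE h_sym => /andP[].
    by rewrite muln0; move: aZ; rewrite inE -ltnNge => /ltnW.
  by rewrite big_split /= -big_distrr /= -card_sumb sum_nat_const mulnC [_ * d0]mulnC mulnC.
have : b * l * #|V| <= b * l * (60 * #|Z|) by nia.
by rewrite leq_pmul2l //; lia.
Qed.

Let T := 128 * q.
Let M := 3 * T.+1.
Hypothesis q_large : 4 * 60 ^ 2 * 120 ^ 2 * l ^ 2 <= q.
Hypothesis q_gt0 : 0 < q.
Hypothesis bl_large : 2 * (2 * (4096 * 256) * M ^ 3) + 4 <= b * l.

Lemma bl_square c : c <= 4096 -> c * M ^ 2 <= b * l.
Proof. by move=> c4; apply: square_le_cube c4 _ bl_large. Qed.

Lemma V_large : 128 * M ^ 2 <= #|V|.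
Proof.
have S : \sum_x #|[set y | h x y]| <= #|V| * #|V|.
  by rewrite -sum_nat_const; apply: leq_sum => x _; apply: max_card.
have : 2 * (b * l) <= #|V| by rewrite -(leq_pmul2r V_gt0); apply: leq_trans S.
by apply: leq_trans; apply: leq_trans (bl_square _) _; rewrite // leq_pmull.
Qed.

Lemma expander_dense_paths : exists X Y : seq V,
  [/\ uniq (X ++ Y), sorted h X, sorted h Y &
   512 * (size X + size Y + 2) <=
    #|[set p : V * V | [&& p.1 \in X, p.2 \in Y & h p.1 p.2]]|].
Proof.
(* If [A] avoids a set [Z] of at least |V| / 120 vertices, its complement has at least |A| / 120
   elements, so [expand] yields conductance b / 120 on such [A]. *)
pose D := 60 * (b * l); pose phi : rat := (b%:R / 120%:R)%R.
have bl0 : 0 < b * l by apply: leq_trans bl_large; rewrite addnS.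
have M0 : 0 < M by [].
have D0 : 0 < D by rewrite muln_gt0.
have phi0 : (0 <= phi)%R by rewrite divr_ge0.
have phiq : (4%:R * D%:R ^+ 2 <= q%:R * phi ^+ 2 :> rat)%R.
  apply: conductance_ratio => //.
  apply: leq_trans (_ : 4 * 60 ^ 2 * 120 ^ 2 * l ^ 2 * b ^ 2 <= _); last by rewrite leq_mul2r q_large orbT.
  by apply: eq_leq; rewrite /D !expnMn; ring.
have [mu [[mu0 mu1 muw] [muh mug mux]]] :=
  gadget_weights h_sym h_irr D0 deg_le phi0 q_gt0 phiq V_gt0.
have VM := V_large.
pose m := #|V| %/ (128 * M ^ 2).
have M2 : 0 < 128 * M ^ 2 by rewrite muln_gt0 expn_gt0.
have m0 : 0 < m by rewrite divn_gt0.
have mM : 128 * m * M ^ 2 <= #|V|.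
  by rewrite mulnAC mulnC; apply: leq_trunc_div.
have Vm : #|V| <= m * (256 * M ^ 2).
  by rewrite (_ : 256 = 2 * 128) // -mulnA; apply: trunc_double.
(* The paths will have at most m M vertices each and at least k m / 2 edges between them;
   [k = 4096 * M] makes this at least 512 (2 m M + 2). *)
pose d0 := (b * l) %/ 2; pose k := 4096 * M.
have d0bl : 2 * d0 <= b * l by rewrite mulnC; apply: leq_trunc_div.
have d0l : 2 * (4096 * 256) * M ^ 3 < d0 by apply: half_large.
have DM : 8 * M ^ 2 <= D by apply: leq_trans (bl_square _) _; rewrite // leq_pmull.
have bud : 2 * (k * #|V|) < m * d0 by apply: budget_arith.
have win (i : nat) (Z : {set V}) : i < 3 -> #|V| <= 120 * #|Z| ->
    (\sum_g mu g * (~~ has (mem Z) (window T i g))%:R <= 2%:R ^- 64)%R.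
  move=> i3 VZ; apply: mux => // A AZ.
  rewrite /phi mulrAC ler_pdivrMr // -!natrM ler_nat.
  have := expand A; rewrite -(leq_pmul2r (isT : 0 < 120)); apply: leq_trans.
  rewrite -mulnA leq_mul2l; apply/orP; right.
  have : #|Z| <= #|~: A| by apply: subset_leq_card; rewrite subsetC.
  by move=> ZA; apply: min_expand ZA VZ _; apply: max_card.
have [w [J [cJ Jg Jd JQ]]] := good_family mu0 mu1 muw muh mug win
  (fun W => fresh_card bl0 d0bl (W := W)) m0 V_gt0 mM DM bud.
(* Last windows of [F] against first windows of [U]: a vertex of a first window that is full with
   respect to last windows gives an arc. *)
have arcs (F U : {set 'I_(8 * m)}) : F \subset J -> U \subset J -> [disjoint F & U] ->
    m <= #|F| -> m <= #|U| -> exists f u, [/\ f \in F, u \in U & arc h w f u].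
  move=> FJ UJ dFU /exists_subset_card[F' sF F'm] /exists_subset_card[U' sU U'm].
  have dFU' : [disjoint F' & U'] by apply: disjointWl sF _; apply: disjointWr sU _.
  have := JQ 2 0 F' U' isT F'm U'm dFU'; set B := [set i in U' | _] => mB.
  have [u] : exists u, u \in B.
    by apply/set0Pn; rewrite -card_gt0; apply: half_gt0 mB.
  rewrite inE => /andP[uU /hasP[x xw]]; rewrite !inE => kx.
  have [f] : exists f, f \in [set i in F' | x \in nbr h T 2 (w i)].
    by apply/set0Pn; rewrite -card_gt0; apply: leq_trans kx; rewrite muln_gt0.
  rewrite !inE => /andP[fF /hasP[y yw xy]].
  exists f, u; split; [exact: (subsetP sF)|exact: (subsetP sU)|].
  by apply/hasP; exists y => //; apply/hasP; exists x; rewrite // h_sym.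
have [p [up sp pJ sz]] := dfs_long_path arcs.
have szp : 2 * m < size p by apply: long_path_size cJ sz.
have chain (p' : seq 'I_(8 * m)) : 0 < size p' -> uniq p' -> sorted (arc h w) p' ->
   {subset p' <= p} -> exists X : seq V, [/\ sorted h X, uniq X,
    forall v, v \in X -> exists2 j, j \in p' & v \in w j,
    forall j v, j \in p' -> v \in window T 1 (w j) -> v \in X &
    size X <= size p' * M].
  case: p' => [//|i p'] _ up' sp' sub.
  have [a aw] := @window_neq0 V T 0 (w i) (size_tuple _) isT.
  have [X [X1 X2 X3 X4 X5]] := gadget_chain Jg Jd sp' up' (fun j jp => pJ j (sub j jp)) aw.
  by exists (a :: X).
(* The search path has more than 4 m - 2 m gadgets, so it splits off two disjoint stretches of [m]
   gadgets, one for each path. *)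
pose p1 := take m p; pose p2 := take m (drop m p).
have szp1 : m <= size p by apply: leq_trans (ltnW szp); rewrite leq_pmull.
have s1 : size p1 = m by apply: size_takel.
have s2 : size p2 = m.
  by apply: size_takel; rewrite size_drop leq_subRL // addnn -mul2n ltnW.
have d12 i : i \in p1 -> i \in p2 -> False.
  move=> i1 /mem_take i2; move: up; rewrite -(cat_take_drop m p) cat_uniq.
  by move=> /and3P[_ /hasPn/(_ i i2)]; rewrite /= i1.
have u1 : uniq p1 by apply: take_uniq.
have u2 : uniq p2 by apply/take_uniq/drop_uniq.
have [||||X [X1 X2 X3 X4 X5]] := chain p1; rewrite ?s1 //.
- exact: take_sorted.
- by move=> z /mem_take.
have [||||Y [Y1 Y2 Y3 Y4 Y5]] := chain p2; rewrite ?s2 //.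
- by apply/take_sorted/drop_sorted.
- by move=> z /mem_take /mem_drop.
rewrite s1 in X5; rewrite s2 in Y5.
have p1J i : i \in p1 -> i \in J by move=> /mem_take /pJ.
have p2J i : i \in p2 -> i \in J by move=> /mem_take /mem_drop /pJ.
exists X, Y; split => //.
  rewrite cat_uniq X2 Y2 andbT; apply/hasPn => v /Y3[j j2 vj]; apply/negP => /X3[i i1 vi].
  by apply: (d12 i) => //; rewrite (Jd i j v (p1J i i1) (p2J j j2) vi vj).
pose F := [set i in p1]; pose U := [set i in p2].
have Fm : #|F| = m by rewrite cardsE (card_uniqP u1).
have Um : #|U| = m by rewrite cardsE (card_uniqP u2).
have dFU : [disjoint F & U].
  by apply/pred0P => i /=; rewrite !inE; apply/negP => /andP[]; apply: d12.
(* Now middle windows against middle windows: these lie entirely on the two paths, so every edge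
   found joins [X] to [Y]. *)
have := JQ 1 1 F U isT Fm Um dFU; set U1 := [set i in U | _] => mU1.
pose B := [set y in Y | y \in full k (fun i => nbr h T 1 (w i)) F].
have cB : #|U1| <= #|B|.
  apply: (card_transversal (w := w) (J := J)) => //.
    by apply/subsetP => i; rewrite !inE => /andP[/p2J].
  move=> i; rewrite !inE => /andP[i2 /hasP[y yw yf]]; exists y; last exact: window_sub yw.
  by rewrite inE (Y4 i).
(* A vertex of [B] has neighbours in the middle windows of [k] gadgets of [F]. These gadgets are
   disjoint, so the neighbours can be chosen distinct, and they lie on [X]. *)
have edges : k * #|B| <= #|[set p : V * V | [&& p.1 \in X, p.2 \in Y & h p.1 p.2]]|.
  set E := [set p | _].
  have -> : #|E| = \sum_x \sum_y nat_of_bool ((x, y) \in E).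
    by rewrite card_sumb pair_bigA; apply: eq_bigr => -[].
  rewrite exchange_big mulnC -sum_nat_const big_mkcond /=; apply: leq_sum => y _.
  case: ifP => //; rewrite inE => /andP[yY]; rewrite inE => ky.
  apply: leq_trans ky _; apply: leq_trans (_ : #|[set x in X | h x y]| <= _).
    apply: (card_transversal (w := w) (J := J)) => //.
      by apply/subsetP => i; rewrite !inE => /andP[/p1J].
    move=> i; rewrite !inE => /andP[i1 /hasP[x xw yx]]; exists x; last exact: window_sub xw.
    by rewrite inE (X4 i) // h_sym.
  by rewrite card_sumb; apply: leq_sum => x _; rewrite !inE /= yY.
have : 512 * (size X + size Y + 2) * 2 <= k * #|B| * 2.
  apply: leq_trans (_ : k * m <= _); last first.
    rewrite -mulnA leq_mul2l; apply/orP; right.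
    by apply: leq_trans mU1 _; rewrite mulnC leq_mul2r.
  exact: paths_vs_edges.
rewrite leq_pmul2r // => H; exact: leq_trans edges.
Qed.

End Expander.

(** * Passing to an expander of bounded degree *)

(** The union is at least twice the smaller part, so the logarithm grows by at least one for each of
    the [a] elements of that part. *)
Lemma trunc_log_merge a a' : 0 < a -> a <= a' ->
  a * trunc_log 2 a + a' * trunc_log 2 a' + a <= (a + a') * trunc_log 2 (a + a').
Proof.
move=> a0 aa; rewrite mulnDl.
have h1 : (trunc_log 2 a).+1 <= trunc_log 2 (a + a').
  by rewrite -trunc_log2_double // leq_trunc_log // -addnn leq_add2l.
have h2 : trunc_log 2 a' <= trunc_log 2 (a + a') by rewrite leq_trunc_log // leq_addl.
have := leq_mul (leqnn a) h1; have := leq_mul (leqnn a') h2; rewrite mulnS; lia.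
Qed.

Section ExpanderSubset.
Variables (V : finType) (h : rel V).
Hypothesis h_sym : symmetric h.

Definition arcs (A B : {set V}) := \sum_(x in A) \sum_(y in B) h x y.

Lemma arcs_sym A B : arcs A B = arcs B A.
Proof.
by rewrite /arcs exchange_big; apply: eq_bigr => x _; apply: eq_bigr => y _; rewrite h_sym.
Qed.

Lemma arcs_split (A S : {set V}) : A \subset S ->
  arcs S S = arcs A A + arcs (S :\: A) (S :\: A) + 2 * arcs A (S :\: A).
Proof.
move=> AS.
have sp (F : V -> nat) : \sum_(x in S) F x = \sum_(x in A) F x + \sum_(x in S :\: A) F x.
  by rewrite (big_setID A) /=; congr (_ + _); apply: eq_bigl => x; rewrite (setIidPr AS).
have E : arcs S S = arcs A A + arcs A (S :\: A) + (arcs (S :\: A) A + arcs (S :\: A) (S :\: A)).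
  rewrite {1}/arcs sp /arcs -!big_split /=.
  by congr (_ + _); apply: eq_bigr => x _; rewrite sp.
by rewrite E [arcs (S :\: A) A]arcs_sym; lia.
Qed.

(** A smallest nonempty set meeting the density threshold works. Both sides of a cut miss their own
    thresholds, which by [trunc_log_merge] add up to at least [e] times the smaller side less than
    the threshold of [S]; the arcs of the cut, counted in both directions, must make up the
    difference. *)
Lemma expander_subset (c e : nat) (S0 : {set V}) : 0 < #|S0| ->
  #|S0| * (c + e * trunc_log 2 #|S0|) <= arcs S0 S0 ->
  exists S : {set V}, [/\ 0 < #|S|, #|S| * (c + e * trunc_log 2 #|S|) <= arcs S S &
    forall A : {set V}, A \subset S -> e * minn #|A| #|S :\: A| <= 2 * arcs A (S :\: A)].
Proof.
move=> S00 H0.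
pose P (S : {set V}) := (0 < #|S|) && (#|S| * (c + e * trunc_log 2 #|S|) <= arcs S S).
have PS0 : P S0 by rewrite /P S00.
case: (@arg_minnP _ S0 P (fun S => #|S|) PS0) => S /andP[Sp SH] Smin.
exists S; split => // A AS.
have cS : #|A| + #|S :\: A| = #|S| by rewrite -(cardsID A S) (setIidPr AS).
have small (B : {set V}) : 0 < #|B| -> #|B| < #|S| ->
    arcs B B < #|B| * (c + e * trunc_log 2 #|B|).
  move=> B0 BS; rewrite ltnNge; apply/negP => BH.
  by have := Smin B; rewrite /P B0 BH /= leqNgt BS => /(_ isT).
have [A0|A0] := posnP #|A|; first by rewrite A0 min0n muln0.
have [B0|B0] := posnP #|S :\: A|; first by rewrite B0 minn0 muln0.
have hA : arcs A A < #|A| * (c + e * trunc_log 2 #|A|) by apply: small => //; lia.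
have hB : arcs (S :\: A) (S :\: A) < #|S :\: A| * (c + e * trunc_log 2 #|S :\: A|).
  by apply: small => //; lia.
move: SH; rewrite (arcs_split AS) -cS.
move: hA hB; move: (arcs A A) (arcs _ (S :\: A)) (arcs A _) => x y z hA hB.
move: #|A| #|S :\: A| A0 B0 hA hB => a a' a0 b0 hA hB SH.
have merge : a * trunc_log 2 a + a' * trunc_log 2 a' + minn a a' <= (a + a') * trunc_log 2 (a + a').
  have [le|le] := leqP a a'; first exact: trunc_log_merge.
  by rewrite addnC [a + a']addnC [a * _ + _]addnC addnC; apply: trunc_log_merge => //; apply: ltnW.
have := leq_mul (leqnn e) merge; move: hA hB SH.
move: (trunc_log 2 a) (trunc_log 2 a') (trunc_log 2 (a + a')) (minn a a') => p q r s.
nia.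
Qed.

End ExpanderSubset.

Section DensePaths.
Variables (V : finType) (h : rel V) (b l q : nat) (S0 : {set V}).
Hypothesis h_sym : symmetric h.
Hypothesis h_irr : irreflexive h.
Hypothesis deg_le : forall x, #|[set y | h x y]| <= 60 * (b * l).
Hypothesis S0_gt0 : 0 < #|S0|.
Hypothesis S0_dense : #|S0| * (2 * (2 * (b * l))) <= arcs h S0 S0.
Hypothesis log_le : trunc_log 2 #|S0| <= l.
Hypothesis q_large : 4 * 60 ^ 2 * 120 ^ 2 * l ^ 2 <= q.
Hypothesis q_gt0 : 0 < q.
Hypothesis bl_large : 2 * (2 * (4096 * 256) * (3 * (128 * q).+1) ^ 3) + 4 <= b * l.

Lemma dense_paths : exists X Y : seq V,
  [/\ uniq (X ++ Y), sorted h X, sorted h Y &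
   512 * (size X + size Y + 2) <=
    #|[set p : V * V | [&& p.1 \in X, p.2 \in Y & h p.1 p.2]]|].
Proof.
(* The density 4 b l is split in two: 2 b l remains as average degree, and the other half pays for
   expansion with [e = 2 * b], since the logarithm is at most [l]. *)
have H0 : #|S0| * (2 * (b * l) + 2 * b * trunc_log 2 #|S0|) <= arcs h S0 S0.
  apply: leq_trans S0_dense; rewrite leq_mul2l; apply/orP; right.
  by rewrite [leqRHS]mul2n -addnn leq_add2l -mulnA leq_mul2l leq_mul2l log_le !orbT.
have [S [Sp SH SA]] := expander_subset h_sym S0_gt0 H0.
pose W : finType := {x | x \in S}; pose g : rel W := relpre val h.
have cW : #|W| = #|S| by rewrite card_sig; apply: eq_card => x; rewrite !inE.
have degW (x : W) : #|[set y | g x y]| = \sum_(y in S) h (val x) y.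
  by rewrite card_sumb [RHS]big_sub; apply: eq_bigr => y _; rewrite inE.
have imE (A : {set W}) : val @: (~: A) = S :\: (val @: A).
  apply/setP => x; rewrite inE; apply/imsetP/andP => [[y yA ->]|[xA xS]].
    split; last exact: valP; apply/imsetP => -[z zA /val_inj yz].
    by move: yA; rewrite inE yz zA.
  exists (Sub x xS : W) => //; rewrite inE; apply: contra xA => xA.
  by apply/imsetP; exists (Sub x xS : W).
have [||||||X [Y [UXY sX sY big]]] := @expander_dense_paths W g b l q _ _ _ _ _ _ q_large q_gt0 bl_large.
- by move=> x y; apply: h_sym.
- by move=> x; apply: h_irr.
- move=> x; apply: leq_trans (deg_le (val x)).
  rewrite degW [leqRHS]card_sumb [leqLHS]big_mkcond; apply: leq_sum => y _.
  by rewrite inE; case: ifP.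
- rewrite cW mulnC; apply: leq_trans (leq_trans _ SH) _.
    by rewrite leq_mul2l leq_addr orbT.
  by rewrite /arcs big_sub; apply: eq_leq; apply: eq_bigr => x _; rewrite degW.
- move=> A; have := SA (val @: A).
  have AS : val @: A \subset S by apply/subsetP => x /imsetP[y _ ->]; apply: valP.
  rewrite -imE !card_imset; try exact: val_inj.
  move=> /(_ AS); rewrite -mulnA leq_pmul2l // => H; apply: leq_trans H _.
  rewrite /arcs big_imset /=; last by move=> ? ? _ _; apply: val_inj.
  apply: eq_leq; apply: eq_bigr => x _; rewrite big_imset //.
  by move=> ? ? _ _; apply: val_inj.
- by rewrite cW.
exists (map val X), (map val Y); split.
- by rewrite -map_cat map_inj_uniq //; apply: val_inj.
- by rewrite sorted_map.
- by rewrite sorted_map.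
rewrite !size_map; apply: leq_trans big _.
pose f (p : W * W) := (val p.1, val p.2).
have f_inj : injective f by move=> [x y] [x' y'] [/val_inj-> /val_inj->].
rewrite -(card_imset _ f_inj); apply: subset_leq_card; apply/subsetP => p.
move=> /imsetP[[x y]]; rewrite !inE /= => /and3P[xX yY xy] ->.
by rewrite (map_f val xX) (map_f val yY).
Qed.

End DensePaths.

Section Regularisation.
Variables (V : finType) (r : rel V).
Hypothesis r_sym : symmetric r.
Hypothesis r_irr : irreflexive r.

(** In a smallest nonempty set of average degree at least 2 d, deleting a vertex of degree below [d]
    would preserve that average. *)
Lemma min_degree_subset (d : nat) (S0 : {set V}) : 0 < d -> 0 < #|S0| ->
  2 * d * #|S0| <= arcs r S0 S0 ->
  exists S : {set V}, 0 < #|S| /\ forall x, x \in S -> d <= #|[set y in S | r x y]|.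
Proof.
move=> d0 S00 H0.
pose P (S : {set V}) := (0 < #|S|) && (2 * d * #|S| <= arcs r S S).
have PS0 : P S0 by rewrite /P S00.
case: (@arg_minnP _ S0 P (fun S => #|S|) PS0) => S /andP[Sp SH] Smin.
exists S; split => // x xS.
have xSS : [set x] \subset S by rewrite sub1set.
have cS := cardsD1 x S; rewrite xS in cS.
have deg : arcs r [set x] (S :\ x) <= #|[set y in S | r x y]|.
  rewrite /arcs big_set1 card_sumb big_mkcond /=; apply: leq_sum => y _.
  by rewrite !inE; case: eqP => //= _; case: (y \in S).
have x0 : arcs r [set x] [set x] = 0 by rewrite /arcs !big_set1 r_irr.
have := arcs_split r_sym xSS; rewrite x0 => E.
apply: leq_trans deg; rewrite leqNgt; apply/negP => lt.
have [S1|S1] := posnP #|S :\ x|.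
  have x1 : arcs r (S :\ x) (S :\ x) = 0.
    by move/eqP: S1; rewrite cards_eq0 => /eqP ->; rewrite /arcs big_set0.
  by move: SH; rewrite E x1 cS S1; lia.
have F : arcs r (S :\ x) (S :\ x) < 2 * d * #|S :\ x|.
  rewrite ltnNge; apply/negP => H; have := Smin (S :\ x).
  by rewrite /P S1 H cS => /(_ isT); rewrite add1n ltnn.
by move: SH F; rewrite E cS mulnDr muln1; move: (arcs _ _ _) (arcs _ _ _) lt (2 * d * _); lia.
Qed.

Definition outs (E : {set V * V}) a := [set b | (a, b) \in E].
Definition ins (E : {set V * V}) b := [set a | (a, b) \in E].

Lemma in_outs E a b : (b \in outs E a) = ((a, b) \in E).
Proof. by rewrite inE. Qed.

Lemma in_ins E a b : (a \in ins E b) = ((a, b) \in E).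
Proof. by rewrite inE. Qed.

Lemma sum_outs E : \sum_a #|outs E a| = #|E|.
Proof.
rewrite card_sumb; under eq_bigr do rewrite card_sumb.
by rewrite pair_bigA; apply: eq_bigr => -[a b] _; rewrite inE.
Qed.

Lemma sum_ins E : \sum_b #|ins E b| = #|E|.
Proof.
rewrite -sum_outs; under eq_bigr do rewrite card_sumb.
rewrite exchange_big /=; apply: eq_bigr => a _; rewrite card_sumb.
by apply: eq_bigr => b _; rewrite !inE.
Qed.

(** Ordered pairs describe a subgraph of the bipartite double cover, so [A] and [B] may overlap.
    Sources have degree exactly [k], targets at most twice that. *)
Definition degree_system (k : nat) (A B : {set V}) (E : {set V * V}) :=
  [&& [forall p in E, [&& p.1 \in A, p.2 \in B & r p.1 p.2]],
      [forall a in A, #|outs E a| == k] & [forall b, #|ins E b| <= 2 * k]].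

Lemma degree_systemP k (A B : {set V}) (E : {set V * V}) : reflect
  [/\ forall a b, (a, b) \in E -> [/\ a \in A, b \in B & r a b],
      forall a, a \in A -> #|outs E a| = k & forall b, #|ins E b| <= 2 * k]
  (degree_system k A B E).
Proof.
apply: (iffP and3P) => -[H1 H2 H3]; split.
- by move=> a b abE; have := forallP H1 (a, b); rewrite abE /= => /and3P.
- by move=> a aA; apply/eqP; have := forallP H2 a; rewrite aA.
- by move=> b; apply: (forallP H3).
- by apply/forallP => -[a b]; apply/implyP => /H1 /= [-> -> ->].
- by apply/forallP => a; apply/implyP => /H2 ->.
- by apply/forallP.
Qed.

Lemma degree_system_card k (A B : {set V}) (E : {set V * V}) : degree_system k A B E -> #|E| = k * #|A|.
Proof.
move=> /degree_systemP[H1 H2 _]; rewrite -sum_outs mulnC -sum_nat_const [RHS]big_mkcond.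
apply: eq_bigr => a _; case: (boolP (a \in A)) => [/H2//|aA].
by apply/eqP; rewrite cards_eq0; apply/eqP/setP => b; rewrite !inE; apply: contraNF aA => /H1[].
Qed.

(* Saturate greedily: add sources with k out-arcs as long as in-degrees stay at
   most 2k.  If this stops too early, the remaining sources send all but k of
   their arcs to saturated targets, and these are few. *)
Lemma regular_part (k t : nat) (A B : {set V}) : 0 < k -> #|B| < 2 ^ t -> 0 < #|A| ->
  #|B| <= 2 * #|A| -> (forall a, a \in A -> k * t.+1 <= #|[set b in B | r a b]|) ->
  exists (A' B' : {set V}) (E : {set V * V}), [/\ 0 < #|A'|, #|B'| <= 4 * #|A'| & degree_system k A' B' E].
Proof.
move=> k0; elim: t A B => [|t IH] A B Bt A0 BA deg.
all: have [a0 a0A] : exists a, a \in A by apply/set0Pn; rewrite -card_gt0.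
all: have B0 : 0 < #|B| by apply: leq_trans (leq_trans (deg a0 a0A) _);
  rewrite ?muln_gt0 ?k0 //; apply: subset_leq_card; apply/subsetP => b; rewrite inE => /andP[].
  by move: Bt B0; rewrite expn0; case: #|B|.
pose P (p : {set V} * {set V * V}) := (p.1 \subset A) && degree_system k p.1 B p.2.
have P0 : P (set0, set0).
  rewrite /P sub0set; apply/degree_systemP; split.
  - by move=> a b; rewrite inE.
  - by move=> a; rewrite inE.
  - by move=> b; rewrite (_ : ins _ _ = set0) ?cards0 //; apply/setP => a; rewrite !inE.
case: (@arg_maxnP _ (set0, set0) P (fun p => #|p.1|) P0) => -[A' E] /andP[/= A'A dE] Amax.
have [big|small] := leqP #|B| (4 * #|A'|).
  exists A', B, E; split => //; rewrite lt0n; apply: contraTneq big => ->.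
  by rewrite muln0 -ltnNge.
have /degree_systemP[H1 H2 H3] := dE.
pose Bs := [set b in B | #|ins E b| == 2 * k].
(* Every saturated target absorbs 2 k of the k |A'| arcs. *)
have cBs : 2 * #|Bs| <= #|A'|.
  rewrite -(leq_pmul2l k0) -(degree_system_card dE) mulnA [k * 2]mulnC mulnC -sum_nat_const.
  rewrite -sum_ins big_mkcond; apply: leq_sum => b _; rewrite inE.
  by case: ifP => // /andP[_ /eqP->].
(* Otherwise [a], with [k] arcs to unsaturated targets, would enlarge the maximal system. *)
have unsat a : a \in A :\: A' -> #|[set b in B :\: Bs | r a b]| < k.
  rewrite inE => /andP[aA' aA]; rewrite ltnNge; apply/negP => /exists_subset_card[N sN cN].
  pose E' := E :|: [set (a, b) | b in N].
  have inE' x y : ((x, y) \in E') = ((x, y) \in E) || (x == a) && (y \in N).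
    rewrite inE; congr (_ || _); apply/imsetP/andP => [[z zN [-> ->]]|[/eqP-> yN]].
      by rewrite eqxx.
    by exists y.
  have NP b : b \in N -> [/\ b \in B, #|ins E b| < 2 * k & r a b].
    move=> /(subsetP sN); rewrite !inE negb_and => /andP[/andP[h1 bB] rab].
    by move: h1; rewrite bB /= ltn_neqAle H3 andbT.
  have : P (a |: A', E').
    apply/andP; split; first by rewrite subUset sub1set aA.
    apply/degree_systemP; split => /=.
    - move=> x y; rewrite inE' => /orP[/H1[xA yB xy]|/andP[/eqP-> /NP[yB _ ay]]].
        by rewrite !inE xA orbT.
      by rewrite !inE eqxx.
    - move=> x; rewrite !inE => /orP[/eqP->|xA'].
        rewrite -cN; congr #|pred_of_set _|; apply/setP => y; rewrite in_outs inE' eqxx /=.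
        by case: (boolP (_ \in E)) => // /H1[]; rewrite (negbTE aA').
      rewrite -(H2 x xA'); congr #|pred_of_set _|; apply/setP => y; rewrite !in_outs inE'.
      by case: (eqVneq x a) xA' aA' => [->->//|_ _ _]; rewrite orbF.
    - move=> y; case: (boolP (y \in N)) => yN.
        have [_ lt _] := NP y yN; apply: leq_trans lt.
        apply: leq_trans (_ : #|a |: ins E y| <= _); last first.
          by rewrite cardsU1; case: (_ \notin _).
        apply: subset_leq_card; apply/subsetP => x; rewrite in_ins inE' in_setU1 in_ins => /orP[->|/andP[->]] //.
        by rewrite orbT.
      apply: leq_trans (H3 y); apply: subset_leq_card; apply/subsetP => x.
      by rewrite !in_ins inE' (negbTE yN) andbF orbF.
  by move=> /Amax; rewrite /= /geq /= cardsU1 aA' add1n ltnn.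
have cA : #|A :\: A'| + #|A'| = #|A| by rewrite -(cardsID A' A) (setIidPr A'A) addnC.
have BtE : 2 ^ t.+1 = 2 * 2 ^ t by rewrite expnS.
(* Since 4 |A'| < |B| <= 2 |A|, more than half of the sources remain and fewer than |B| / 8 targets
   do; each remaining source has lost fewer than [k] arcs, which lowers [t] by one. *)
apply: (IH (A :\: A') Bs); [lia|lia|lia|].
move=> a aA2; have aA : a \in A by move: aA2; rewrite inE => /andP[].
have := deg a aA; have := unsat a aA2.
have : #|[set b in B | r a b]| <= #|[set b in Bs | r a b]| + #|[set b in B :\: Bs | r a b]|.
  apply: leq_trans (leq_card_setU _ _).1; apply: subset_leq_card; apply/subsetP => b.
  by rewrite !inE => /andP[-> ->]; rewrite !andbT /= orbN.
rewrite [k * t.+2]mulnS; lia.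
Qed.

(** Forgetting directions gives degrees at most k + 2 k, while the k |A| arcs live on at most 5 |A|
    vertices. *)
Lemma regular_subgraph k (A B : {set V}) (E : {set V * V}) : degree_system k A B E -> 0 < #|A| -> #|B| <= 4 * #|A| ->
  exists (h : rel V) (S : {set V}),
  [/\ symmetric h, subrel h r, forall x, #|[set y | h x y]| <= 3 * k, 0 < #|S| &
      k * #|S| <= 5 * arcs h S S].
Proof.
move=> dE A0 BA; have cE := degree_system_card dE; have /degree_systemP[H1 H2 H3] := dE.
exists (fun x y => ((x, y) \in E) || ((y, x) \in E)), (A :|: B); split.
- by move=> x y; rewrite orbC.
- by move=> x y /orP[/H1[]|/H1[_ _]] //; rewrite r_sym.
- move=> x; apply: leq_trans (_ : #|outs E x :|: ins E x| <= _).
    by apply: subset_leq_card; apply/subsetP => y; rewrite !inE.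
  apply: leq_trans (leq_card_setU _ _).1 _; have := H3 x.
  have : #|outs E x| <= k.
    case: (boolP (x \in A)) => [/H2->//|xA].
    rewrite (_ : outs E x = set0) ?cards0 //; apply/setP => y; rewrite !inE.
    by apply: contraNF xA => /H1[].
  lia.
- by apply: leq_trans A0 _; apply: subset_leq_card; apply: subsetUl.
have cS : #|A :|: B| <= 5 * #|A| by apply: leq_trans (leq_card_setU _ _).1 _; lia.
apply: leq_trans (_ : k * (5 * #|A|) <= _); first by rewrite leq_mul2l cS orbT.
rewrite mulnCA -cE leq_mul2l /= -sum_outs /arcs.
rewrite [leqRHS]big_mkcond; apply: leq_sum => x _ /=; rewrite card_sumb.
case: ifP => xS; last first.
  rewrite big1 // => y _; rewrite inE; case: (boolP (_ \in E)) => // /H1[xA].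
  by move: xS; rewrite inE xA.
rewrite [leqRHS]big_mkcond; apply: leq_sum => y _ /=; rewrite !inE.
by case: (boolP ((x, y) \in E)) => [/H1[_ -> _]|//]; rewrite orbT.
Qed.

End Regularisation.

(** * Choice of parameters and conclusion *)

Lemma edges_le_arcs (G : sgraph) : #|edges G| <= arcs (@adj G) setT setT.
Proof.
apply: leq_trans (leq_imset_card _ _) _.
have -> : arcs (@adj G) setT setT = \sum_(p : G * G) nat_of_bool (adj p.1 p.2).
  rewrite /arcs -(pair_bigA _ (fun x y : G => nat_of_bool (adj x y))) /=.
  by apply: eq_big => [x|x _]; rewrite ?inE //; apply: eq_bigl => y; rewrite inE.
rewrite -sum1_card big_mkcond; apply: leq_sum => p _.
by rewrite inE; case: adj.
Qed.

Lemma gadget_length_le l : 400 <= l -> 3 * (128 * l ^ 3).+1 <= l ^ 4.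
Proof.
move=> l4; have : 0 < l ^ 3 by rewrite expn_gt0; case: l l4.
by rewrite (expnS l 3); move: (l ^ 3) => x; nia.
Qed.

Lemma bl_large_of_log c c' l : 400 <= l -> c + c' <= l ->
  c * (3 * (128 * l ^ 3).+1) ^ 3 + c' <= l ^ 100 * l.
Proof.
move=> l4 cl; have l0 : 0 < l by case: l l4 {cl}.
have h : (3 * (128 * l ^ 3).+1) ^ 3 <= l ^ 12.
  by rewrite (expnM l 4 3) leq_exp2r // gadget_length_le.
apply: leq_trans (_ : (c + c') * l ^ 12 <= _).
  by rewrite mulnDl leq_add ?leq_mul2l ?h ?orbT // leq_pmulr // expn_gt0 l0.
apply: leq_trans (_ : l * l ^ 12 <= _); first by rewrite leq_mul2r cl orbT.
by rewrite -expnS -expnSr leq_pexp2l.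
Qed.

Lemma degree_of_log l : 400 <= l -> 2 * (20 * (l ^ 100 * l) * l.+2) <= l ^ 130.
Proof.
move=> l4; have l0 : 0 < l by case: l l4.
apply: leq_trans (_ : l ^ 103 <= _); last by rewrite leq_pexp2l.
rewrite (expnSr l 102) (expnSr l 101) -expnSr.
have : 0 < l ^ 101 by rewrite expn_gt0 l0.
move: (l ^ 101) => x x0.
have : 2 * (20 * l.+2) <= l * l by nia.
by move=> H; have := leq_mul (leqnn x) H; nia.
Qed.

Lemma cycle_of_many_edges (G : sgraph) (l : nat) :
  4 * 60 ^ 2 * 120 ^ 2 <= l -> 2 * (2 * (4096 * 256)) + 4 <= l -> 400 <= l ->
  trunc_log 2 #|G| = l -> #|G| * l ^ 130 <= #|edges G| ->
  exists c : seq G, is_cycle c /\ size c <= #|chords c|.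
Proof.
move=> l1 l2 l3 lE HE.
have l0 : 0 < l by apply: leq_trans l3.
have G0 : 0 < #|G| by case: #|G| lE l0 => // <-; rewrite trunc_log0.
(* With [k = 20 * (b * l)] the maximum degree 3 k is 60 b l and the density k / 5 is 4 b l, as
   [dense_paths] asks. [regular_part] is run with exponent [l.+1], because |G| < 2^(l+1), so it
   needs minimum degree k (l + 2). The walk parameter [q] will be l^3, which exceeds the required
   multiple of l^2. *)
pose b := l ^ 100; pose k := 20 * (b * l).
have bl0 : 0 < b * l by rewrite muln_gt0 expn_gt0 l0.
have k0 : 0 < k by rewrite muln_gt0.
have [|||S [S0 Sdeg]] := @min_degree_subset G (@adj G) (@adj_sym G) (@adj_irrefl G)
    (k * l.+2) setT.
- by rewrite muln_gt0 k0.
- by rewrite cardsT.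
- apply: leq_trans (edges_le_arcs G); rewrite cardsT mulnC; apply: leq_trans HE.
  by rewrite leq_mul2l degree_of_log ?orbT.
have SG : #|S| <= #|G| by apply: max_card.
have [||A [B [E [A0 BA dE]]]] := @regular_part G (@adj G) k l.+1 S S k0 _ S0 _ Sdeg.
- by apply: leq_ltn_trans SG _; rewrite -lE trunc_log_ltn.
- by rewrite leq_pmull.
have [h [S' [h_sym h_sub h_deg S'0 h_dense]]] := regular_subgraph (@adj_sym G) dE A0 BA.
have [|||||||X [Y [U sX sY XY]]] := @dense_paths G h b l (l ^ 3) S' h_sym _ _ S'0.
- by move=> x; apply/negP => /h_sub; rewrite adj_irrefl.
- by move=> x; apply: leq_trans (h_deg x) _; rewrite /k [leqLHS]mulnA.
- rewrite -(leq_pmul2l (isT : 0 < 5)); apply: leq_trans h_dense.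
  by rewrite /k; apply: eq_leq; ring.
- by rewrite -lE leq_trunc_log // max_card.
- by rewrite [l ^ 3]expnS leq_mul2r l1 orbT.
- by rewrite expn_gt0 l0.
- by rewrite mulnA; apply: bl_large_of_log.
apply: cycle_of_dense_paths U (sub_sorted h_sub sX) (sub_sorted h_sub sY) _.
apply: leq_trans XY _; apply: subset_leq_card; apply/subsetP => -[x y].
by rewrite !inE => /and3P[-> -> /h_sub].
Qed.

Lemma trunc_log_le_log2 (R : realType) (n : nat) : 0 < n ->
  ((trunc_log 2 n)%:R <= log2 (n%:R : R))%R.
Proof.
move=> n0; have ln2 : (0 < ln 2 :> R)%R by rewrite ln_gt0 // ltr1n.
rewrite /log2 ler_pdivlMr // mulr_natl -lnXn //.
rewrite ler_ln ?posrE ?exprn_gt0 ?ltr0n //.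
by rewrite -natrX ler_nat trunc_logP.
Qed.

Unset Implicit Arguments.

Theorem corollary7p2 (R : realType) :
  exists N : nat, forall n : nat, N <= n ->
    forall G : sgraph, #|G| = n ->
      (n%:R * log2 (n%:R : R) ^+ 130 <= #|edges G|%:R)%R ->
      exists c : seq G, is_cycle c /\ size c <= #|chords c|.
Proof.
have bound3 (x y z : nat) : exists L, [/\ x <= L, y <= L & z <= L].
  by exists (x + y + z); split; lia.
(* [L] lies above the three thresholds of [cycle_of_many_edges], and [n >= 2 ^ L] makes the
   truncated logarithm at least [L]. *)
have [L [L1 L2 L3]] := bound3 (4 * 60 ^ 2 * 120 ^ 2) (2 * (2 * (4096 * 256)) + 4) 400.
exists (2 ^ L) => n Nn G Gn H.
have n0 : 0 < n by apply: leq_trans Nn; rewrite expn_gt0.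
have Ll : L <= trunc_log 2 n by rewrite trunc_log_max.
apply: (@cycle_of_many_edges G (trunc_log 2 n)); try exact: leq_trans Ll.
  by rewrite Gn.
rewrite Gn -(ler_nat R) natrM natrX; apply: le_trans H.
apply: ler_wpM2l => //; apply: lerXn2r; rewrite ?nnegrE //.
  exact: le_trans (trunc_log_le_log2 R n0).
exact: trunc_log_le_log2.
Qed.
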